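(* There is a deterministic online algorithm for the online firefighting game on cactus graphs that is $(15\sqrt{n}+1)$-competitive, where $n$ is the number of vertices of the input graph. This is asymptotically optimal: no deterministic online algorithm is $o(\sqrt{n})$-competitive on cactus graphs.
   Context: Online firefighting game: an instance is $\mathcal{I} = (G, r, (f_i)_{i\ge 1})$, where $G$ is a finite undirected graph with $n$ vertices, $r \in V(G)$ is the fire source, and $f_i \ge 0$ are integers. The graph $G$ and $r$ are known to the algorithm in advance; $f_i$ is revealed only at the beginning of round $i$. Initially only $r$ is burning. In round $i$, after learning $f_i$, the algorithm assigns at most $f_i$ firefighters to vertices that are neither burning nor already protected (a protected vertex never burns); then the fire spreads from every burning vertex to all of its unprotected neighbours. A vertex is saved if it never burns. $\mathrm{ALG}(\mathcal{I})$ is the number of vertices saved by algorithm ALG, and $\mathrm{OPT}(\mathcal{I})$ the maximum number of vertices that can be saved by any strategy knowing the whole sequence $(f_i)$ in advance. A deterministic online algorithm makes its round-$i$ decisions as a deterministic function of $G, r, f_1,\dots,f_i$. An algorithm is $c$-competitive (where $c$ may depend on $n$) on a graph class if $\mathrm{OPT}(\mathcal{I})/\mathrm{ALG}(\mathcal{I}) \le c$ for every instance whose graph is in the class and has $n$ vertices. A cactus graph is a graph in which every edge lies on at most one simple cycle (equivalently, any two simple cycles share at most one vertex). *)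

(* Defs.v *)
From HB Require Import structures.
From mathcomp Require Import all_boot all_order all_algebra.
From mathcomp Require Import boolp reals topology normedtype landau.

Set Implicit Arguments.
Unset Strict Implicit.
Unset Printing Implicit Defensive.

Import Order.TTheory GRing.Theory Num.Theory.
Import numFieldNormedType.Exports.

Record sgraph := SGraph {
  vertex :> finType;
  edge : rel vertex;
  edge_sym : symmetric edge;
  edge_irrefl : irreflexive edge
}.

Definition simple_cycle (G : sgraph) (p : seq G) : Prop :=
  ucycle (@edge G) p /\ 2 < size p.

(* A vertex sequence determines a cycle of the graph only up to rotation and
   reversal; cycles are compared through their edge sets. *)
Definition cycle_edges (G : sgraph) (p : seq G) : {set {set G}} :=
  [set [set x; next p x] | x in p].

Definition cactus (G : sgraph) : Prop :=
  forall u v : G, edge u v ->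
  forall p q : seq G, simple_cycle p -> simple_cycle q ->
    [set u; v] \in cycle_edges p -> [set u; v] \in cycle_edges q ->
    cycle_edges p = cycle_edges q.

(* Rounds are numbered from 0: [f i] and [S i] are the number of firefighters
   available in, and the set of vertices newly protected in, the (i+1)-st
   round, while [protected S i] and [burning r S i] are the situation after
   i completed rounds. *)
Definition protected (G : sgraph) (S : nat -> {set G}) (i : nat) : {set G} :=
  \bigcup_(j < i) S j.

Fixpoint burning (G : sgraph) (r : G) (S : nat -> {set G}) (i : nat) :
    {set G} :=
  if i is j.+1 then
    burning r S j :|:
    [set v | (v \notin protected S j.+1)
             && [exists u in burning r S j, edge u v]]
  else [set r].

Definition legal (G : sgraph) (r : G) (f : nat -> nat) (S : nat -> {set G}) :
    Prop :=
  forall i, #|S i| <= f i /\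
            [disjoint S i & burning r S i :|: protected S i].

Definition saved (G : sgraph) (r : G) (S : nat -> {set G}) : {set G} :=
  [set v | `[< forall i, v \notin burning r S i >]].

Definition OPT (G : sgraph) (r : G) (f : nat -> nat) : nat :=
  \max_(k < #|G|.+1 | `[< exists S, legal r f S /\ #|saved r S| = k >]) k.

(* [decide r s] is the move made in the round in which the last entry of [s]
   is revealed, [s] listing the numbers of firefighters of all rounds so
   far. *)
Record online_algorithm := OnlineAlgorithm {
  decide : forall G : sgraph, G -> seq nat -> {set G};
  decide_legal : forall (G : sgraph) (r : G) (f : nat -> nat),
    legal r f (fun i => decide r (mkseq f i.+1))
}.

Definition ALG (A : online_algorithm) (G : sgraph) (r : G) (f : nat -> nat) :
    nat :=
  #|saved r (fun i => decide A r (mkseq f i.+1))|.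

(* The ratio bound OPT / ALG <= c is stated in product form, so that an
   instance with ALG = 0 < OPT violates it for every c (division by 0 would
   return 0). *)
Definition competitive (R : realType) (C : sgraph -> Prop) (c : nat -> R)
    (A : online_algorithm) : Prop :=
  forall (G : sgraph) (r : G) (f : nat -> nat), C G ->
    ((OPT r f)%:R <= c #|G| * (ALG A r f)%:R)%R.

(* Main.v *)
Require Import Defs.
From HB Require Import structures.
From mathcomp Require Import all_boot all_order all_algebra.
From mathcomp Require Import boolp reals topology normedtype landau.
From mathcomp Require Import zify ring lra.
Import Order.TTheory GRing.Theory Num.Theory.
Import numFieldNormedType.Exports.

(* Upper bound. Put s = floor (sqrt n). Saving s vertices is enough, since OPT
   is at most n. In a cactus two disjoint connected sets are joined by at most
   two edges, so every component C of the unburnt graph is enclosed by at most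
   two vertices, and what is protected in C does not matter outside of C. The
   algorithm saves s vertices at once whenever it can. If it cannot and has at
   least two firefighters, every such component is lighter than s and any
   choice will do. With a single firefighter, protecting x saves the weight
   w(x) and keeps, up to some round T(x), the option of enclosing s vertices
   with the next firefighter; the algorithm maximizes T(x) + s * log2 w(x).
   If the next firefighters arrive after T(x), then by maximality the weights
   along the path through a component decay exponentially with the distance
   from the place where the fire stands at T(x), so that the vertices of the
   component that any other choice can keep from burning number O(s w(x)).
   Hence each round costs OPT at most O(s) times what the algorithm gains.

   Lower bound. Attach a cycle of length about m^2 and a star with m leaves to
   the root and announce one firefighter. Unless it is put on the centre of
   the star there are no more firefighters; otherwise there is a second one,
   and OPT could have enclosed nearly the whole cycle. *)

Set Implicit Arguments.
Unset Strict Implicit.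
Unset Printing Implicit Defensive.

(** * The fire as a sequence of balls *)

Section Ball.

Variables (G : sgraph) (r : G).
Implicit Types (D E X : {set G}) (k t : nat) (u v : G).

Fixpoint ball D t : {set G} :=
  if t is t'.+1 then
    ball D t' :|: [set v in D | [exists u in ball D t', edge u v]]
  else [set r].

Definition reach D : {set G} := [set v | `[< exists t, v \in ball D t >]].

Lemma reachP D v : reflect (exists t, v \in ball D t) (v \in reach D).
Proof. by rewrite inE; apply: asboolP. Qed.

Lemma ballSP D t v :
  reflect (v \in ball D t \/
           v \in D /\ exists2 u, u \in ball D t & edge u v)
          (v \in ball D t.+1).
Proof.
rewrite /= inE [X in _ || X]inE; apply: (iffP orP).
  case=> [|/andP[vD /existsP[u /andP[ut uv]]]]; [by left | right].
  by split=> //; exists u.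
case=> [|[vD [u ut uv]]]; [by left | right].
by rewrite vD; apply/existsP; exists u; rewrite ut.
Qed.

Lemma ball_root D t : r \in ball D t.
Proof. by elim: t => [|t IH]; rewrite ?set11 //; apply/ballSP; left. Qed.

Lemma ball_le D t k : t <= k -> ball D t \subset ball D k.
Proof.
move=> /subnKC<-; elim: (k - t) => [|m IH]; first by rewrite addn0.
by rewrite addnS; apply: subset_trans IH (subsetUl _ _).
Qed.

Lemma ball_step D t u v :
  u \in ball D t -> v \in D -> edge u v -> v \in ball D t.+1.
Proof. by move=> ut vD uv; apply/ballSP; right; split=> //; exists u. Qed.

Lemma ball_sub D t v : v \in ball D t -> v = r \/ v \in D.
Proof.
elim: t v => [v|t IH v]; first by rewrite inE => /eqP; left.
by case/ballSP=> [/IH //|[]]; right.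
Qed.

Lemma ball_mono D E t : D \subset E -> ball D t \subset ball E t.
Proof.
move=> /subsetP DE; elim: t => // t /subsetP IH; apply/subsetP => v.
case/ballSP=> [/IH vt|[/DE vE [u /IH ut uv]]]; first by apply/ballSP; left.
exact: ball_step ut vE uv.
Qed.

Lemma ball_reach D t : ball D t \subset reach D.
Proof. by apply/subsetP => v vt; apply/reachP; exists t. Qed.

Lemma reach_root D : r \in reach D.
Proof. by apply/reachP; exists 0; rewrite ball_root. Qed.

Lemma reach_step D u v : u \in reach D -> v \in D -> edge u v -> v \in reach D.
Proof.
by move=> /reachP[t ut] vD uv; apply/reachP; exists t.+1; apply: ball_step uv.
Qed.

Lemma reach_sub D v : v \in reach D -> v = r \/ v \in D.
Proof. by case/reachP => t /ball_sub. Qed.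

Lemma reach_mono D E : D \subset E -> reach D \subset reach E.
Proof.
move=> DE; apply/subsetP => v /reachP[t vt]; apply/reachP; exists t.
exact: subsetP (ball_mono t DE) _ vt.
Qed.

Lemma ball_reachD D X t : ball (reach D :\: X) t = ball (D :\: X) t.
Proof.
apply/eqP; rewrite eqEsubset; apply/andP; split; apply/subsetP.
  elim: t => // t IH v /ballSP[/IH vt|[]]; first by apply/ballSP; left.
  rewrite inE => /andP[vX /reach_sub[->|vD]] [u /IH ut uv].
    by rewrite ball_root.
  by apply: ball_step ut _ uv; rewrite inE vX.
elim: t => // t IH v /ballSP[/IH vt|[]]; first by apply/ballSP; left.
rewrite inE => /andP[vX vD] [u ut uv].
apply: (ball_step (IH _ ut) _ uv); rewrite inE vX.
apply: reach_step vD uv.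
exact: subsetP (reach_mono (subsetDl _ _)) _ (subsetP (ball_reach _ t) _ ut).
Qed.

Lemma reach_reachD D X : reach (reach D :\: X) = reach (D :\: X).
Proof.
by apply/setP => v; apply/reachP/reachP => -[t vt]; exists t; move: vt; rewrite ball_reachD.
Qed.

Lemma ball_setD D X t : [disjoint X & ball D t] -> ball (D :\: X) t = ball D t.
Proof.
elim: t => // t IH dX.
have {}IH : ball (D :\: X) t = ball D t.
  by apply: IH; apply: disjointWr (ball_le _ (leqnSn t)) dX.
apply/setP => v; apply/ballSP/ballSP => -[]; rewrite IH; [by left| |by left|].
  by rewrite inE => -[/andP[_ ->]]; right.
move=> [vD [u ut uv]]; right; split; last by exists u.
rewrite inE vD andbT; apply/negP => vX.
by move/disjointFr: dX => /(_ _ vX); rewrite (ball_step ut vD uv).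
Qed.

Lemma ball_stable D t : ball D t.+1 = ball D t -> reach D = ball D t.
Proof.
move=> st; apply/eqP; rewrite eqEsubset ball_reach andbT.
apply/subsetP => v /reachP[k]; elim: k v => [v|k IH v].
  by rewrite inE => /eqP ->; rewrite ball_root.
case/ballSP=> [/IH //|[vD [u /IH ut uv]]].
by rewrite -st; apply: ball_step uv.
Qed.

Lemma ball_card D t : ball D t <> reach D -> t < #|ball D t|.
Proof.
elim: t => [|t IH] nr; first by rewrite cards1.
have nt : ball D t <> reach D.
  move=> e; apply: nr; apply/eqP; rewrite eqEsubset ball_reach -e.
  exact: ball_le.
apply: leq_ltn_trans (IH nt) (proper_card _).
rewrite properEneq ball_le // andbT; apply/eqP => e.
by apply: nt; rewrite (ball_stable (esym e)).
Qed.

Lemma ball_full D t : #|G| <= t -> ball D t = reach D.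
Proof.
move=> nt; apply/eqP; case: eqP => // /ball_card.
by rewrite ltnNge (leq_trans (max_card _) nt).
Qed.

End Ball.

Arguments ball : simpl never.

Definition restr (G : sgraph) (D : {set G}) : rel G :=
  [rel x y | [&& x \in D, y \in D & edge x y]].

Definition conn (G : sgraph) (D : {set G}) : Prop :=
  forall u v, u \in D -> v \in D -> connect (restr D) u v.

Section Conn.

Variables (G : sgraph).
Implicit Types (D E K Y : {set G}) (u v : G).

Lemma restr_sym D : symmetric (restr D).
Proof. by move=> u v; rewrite /restr /= edge_sym andbCA. Qed.

Lemma restr_csym D : connect_sym (restr D).
Proof. exact: sym_connect_sym (restr_sym D). Qed.

Lemma connect_restr_mono D E u v :
  D \subset E -> connect (restr D) u v -> connect (restr E) u v.
Proof.
move=> /subsetP DE; apply: connect_sub => x y /and3P[/DE xE /DE yE xy].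
by apply: connect1; rewrite /restr /= xE yE.
Qed.

Lemma connect_restr1 D u v :
  u \in D -> v \in D -> edge u v -> connect (restr D) u v.
Proof. by move=> uD vD uv; apply: connect1; rewrite /restr /= uD vD. Qed.

Lemma connect_restr_mem D u v :
  u \in D -> connect (restr D) u v -> v \in D.
Proof.
move=> uD /connectP[p + ->]; elim: p u uD => //= x p IH u uD.
by move=> /andP[/and3P[_ xD _]]; apply: IH.
Qed.

Lemma conn_center D c :
  (forall v, v \in D -> connect (restr D) c v) -> conn D.
Proof.
move=> h u v uD vD; apply: connect_trans (h v vD).
by rewrite restr_csym h.
Qed.

Definition comp D x : {set G} := [set v | connect (restr D) x v].

Lemma comp_root D x : x \in comp D x.
Proof. by rewrite inE connect0. Qed.

Lemma comp_sub D x : x \in D -> comp D x \subset D.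
Proof. by move=> xD; apply/subsetP => v; rewrite inE => /(connect_restr_mem xD). Qed.

Lemma comp_step D x u v :
  u \in D -> v \in D -> edge u v -> u \in comp D x -> v \in comp D x.
Proof.
rewrite !inE => uD vD uv xu; apply: connect_trans xu _.
exact: connect_restr1.
Qed.

Lemma comp_conn D x : x \in D -> conn (comp D x).
Proof.
move=> xD; apply: (@conn_center _ x) => v; rewrite inE => /connectP[p + ->].
elim/last_ind: p => [|p y IH]; first by rewrite connect0.
rewrite rcons_path last_rcons => /andP[pp /and3P[h1 h2 h3]].
apply: connect_trans (IH pp) _; apply: connect_restr1 => //.
  by rewrite inE; apply/connectP; exists p.
rewrite inE; apply: connect_trans (connect_restr1 h1 h2 h3).
by apply/connectP; exists p.
Qed.

Lemma ball_conn r D t : conn (ball r D t).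
Proof.
apply: (@conn_center _ r) => v.
elim: t v => [v|t IH v]; first by rewrite inE => /eqP ->; rewrite connect0.
move=> vS; case/ballSP: (vS) => [vt|[vD [u ut uv]]].
  exact: connect_restr_mono (ball_le _ _ (leqnSn t)) (IH _ vt).
apply: connect_trans (connect_restr_mono (ball_le _ _ (leqnSn t)) (IH _ ut)) _.
apply: connect_restr1 => //; apply/ballSP; by left.
Qed.

Lemma reach_conn r D : conn (reach r D).
Proof.
by rewrite -(ball_full r D (leqnn _)); apply: ball_conn.
Qed.

Lemma conn_exit K D u v : conn D -> u \in D -> v \in D ->
  u \in K -> v \notin K ->
  exists x y, [/\ x \in D, y \in D, x \in K, y \notin K & edge x y].
Proof.
move=> cD uD vD uK vK; have /connectP[p + e] := cD u v uD vD.
rewrite e in vK; elim: p u uD uK vK {e} => [|y p IH] u uD uK /=.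
  by rewrite uK.
move=> lK /andP[/and3P[_ yD uy] pp].
have [yK|yK] := boolP (y \in K); first exact: IH yD yK lK pp.
by exists u, y.
Qed.

Lemma ball_connected_grow r E K y k : conn K -> y \in K -> K \subset E ->
  y \in ball r E k -> K \subset ball r E (k + #|K|).-1.
Proof.
move=> cK yK /subsetP KE yk.
suff h q : K \subset ball r E (k + q) \/ q < #|K :&: ball r E (k + q)|.
  have K0 : 0 < #|K| by apply/card_gt0P; exists y.
  have -> : (k + #|K|).-1 = k + #|K|.-1 by lia.
  case: (h #|K|.-1) => //; rewrite prednK // => h'.
  apply/setIidPl/eqP; rewrite eqEcard subsetIl //.
elim: q => [|q IH].
  by rewrite addn0; right; apply/card_gt0P; exists y; rewrite inE yK.
have le : ball r E (k + q) \subset ball r E (k + q.+1).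
  by rewrite addnS subsetUl.
case: IH => [h|h]; first by left; apply: subset_trans h le.
have [KS|/subsetPn[v vK vn]] := boolP (K \subset ball r E (k + q)).
  by left; apply: subset_trans KS le.
right; apply: (leq_ltn_trans h); apply: proper_card.
have yb : y \in ball r E (k + q) by apply: subsetP yk; apply: ball_le; lia.
have [a [b [aK bK ab bb ed]]] := conn_exit cK yK vK yb vn.
apply/properP; split; first exact: setIS.
exists b; last by rewrite inE bK.
by rewrite inE bK addnS; apply: ball_step ed => //; apply: KE.
Qed.

Lemma conn_partition K Y : conn K -> Y \subset K -> Y != set0 ->
  exists h : G -> G, [/\ forall v, v \in K -> h v \in Y,
    forall y, y \in Y -> h y = y &
    forall v, v \in K -> connect (restr [set u in K | h u == h v]) (h v) v].
Proof.
move=> cK YK /set0Pn[y0 y0Y].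
suff H n (D : {set G}) h : #|K :\: D| <= n -> Y \subset D -> D \subset K ->
  [/\ forall v, v \in D -> h v \in Y, forall y, y \in Y -> h y = y &
    forall v, v \in D -> connect (restr [set u in D | h u == h v]) (h v) v] ->
  exists h : G -> G, [/\ forall v, v \in K -> h v \in Y,
    forall y, y \in Y -> h y = y &
    forall v, v \in K -> connect (restr [set u in K | h u == h v]) (h v) v].
  by apply: (H #|K :\: Y| Y id).
elim: n D h => [|n IH] D h cn YD DK [h1 h2 h3].
  have <- : D = K.
    by apply/eqP; rewrite eqEsubset DK -setD_eq0 -cards_eq0 -leqn0.
  by exists h.
have [KD|/subsetPn[z zK zD]] := boolP (K \subset D).
  have <- : D = K by apply/eqP; rewrite eqEsubset DK.
  by exists h.
have y0D := subsetP YD _ y0Y.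
have [u [v [uK vK uD vD uv]]] := conn_exit cK (subsetP YK _ y0Y) zK y0D zD.
pose h' x := if x == v then h u else h x.
have h'D x : x \in D -> h' x = h x.
  by rewrite /h'; case: eqP => // ->; rewrite (negbTE vD).
have h'v : h' v = h u by rewrite /h' eqxx.
have h'c x : x \in D ->
    connect (restr [set w in v |: D | h' w == h x]) (h x) x.
  move=> xD; apply: connect_restr_mono (h3 _ xD); apply/subsetP => w.
  by rewrite !inE => /andP[wD]; rewrite h'D // wD orbT.
apply: (IH (v |: D) h').
- rewrite -ltnS; apply: (leq_trans _ cn); apply: proper_card; apply/properP; split.
    by apply: setDS; apply: subsetUr.
  by exists v; rewrite !inE ?vD ?vK // eqxx.
- exact: subset_trans YD (subsetUr _ _).
- by rewrite subUset sub1set vK.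
split.
- by move=> x /setU1P[->|xD]; rewrite ?h'v ?h'D //; apply: h1.
- by move=> y yY; rewrite h'D ?h2 //; apply: subsetP YD _ yY.
move=> x /setU1P[->|xD]; last by rewrite h'D //; apply: h'c.
rewrite h'v; apply: connect_trans (h'c _ uD) _.
by apply: connect_restr1; rewrite // !inE ?h'v ?eqxx // uD orbT h'D ?eqxx.
Qed.

End Conn.

(** * Crossing edges and components in a cactus *)

Section Cactus.

Variable (G : sgraph).
Implicit Types (D E K R : {set G}) (u v : G).

Lemma next_cons (x : G) q : next (x :: q) x = head x q.
Proof. by case: q => [|y q]; rewrite /= eqxx. Qed.

Lemma next_split (x : G) a b : uniq (a ++ x :: b) ->
  next (a ++ x :: b) x = head x (b ++ a).
Proof.
move=> u; rewrite -(next_rot (size a) u) rot_size_cat.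
exact: next_cons.
Qed.

Lemma set2_inj (a b c d : G) : [set a; b] = [set c; d] ->
  (a = c /\ b = d) \/ (a = d /\ b = c).
Proof.
move=> /setP e; have := e a; have := e b; have := e c; have := e d.
rewrite !inE !eqxx ?orbT /=.
case: (eqVneq a c) (eqVneq a d) (eqVneq b c) (eqVneq b d) => [->|ac] [ad|ad] [bc|bc] [bd|bd];
  rewrite ?eqxx //=; subst; rewrite ?eqxx //; auto.
all: rewrite ?(eq_sym d) ?(eq_sym c) ?(negbTE ac) ?(negbTE ad) ?(negbTE bc) ?(negbTE bd) //.
Qed.

Lemma next_cross R s1 s2 x : uniq (s1 ++ s2) -> {subset s1 <= R} ->
  x \in s1 -> next (s1 ++ s2) x \notin R ->
  x = last x s1 /\ next (s1 ++ s2) x = head x s2.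
Proof.
move=> us sR xs; move: us sR; case/splitPr: xs => a b.
rewrite -catA cat_cons => us sR; rewrite (next_split us) last_cat.
have aR y : y \in a -> y \in R by move=> ya; apply: sR; rewrite mem_cat ya.
have xR : x \in R by apply: sR; rewrite mem_cat mem_head orbT.
case: b us sR => [|y b] us sR /=; last first.
  by rewrite sR // mem_cat !inE eqxx !orbT.
case: s2 us => [|y s2] us //=.
by case: a us aR {sR} => [|y a] us aR /=; rewrite ?xR // aR ?mem_head.
Qed.

Lemma restr_path_all D u p : path (restr D) u p -> all (mem D) p.
Proof.
elim: p u => //= x p IH u /andP[/and3P[_ xD _] pp].
by rewrite xD (IH _ pp).
Qed.

Lemma restr_path_edge D u p : path (restr D) u p -> path (@edge G) u p.
Proof. by apply: sub_path => x y /and3P[]. Qed.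

Lemma crossing_cycle R K u1 v1 u2 v2 :
  [disjoint R & K] -> conn R -> conn K ->
  u1 \in R -> u2 \in R -> v1 \in K -> v2 \in K ->
  edge u1 v1 -> edge u2 v2 -> (u1, v1) != (u2, v2) ->
  exists p, [/\ simple_cycle p,
    [set u1; v1] \in cycle_edges p, [set u2; v2] \in cycle_edges p &
    forall u v, u \in R -> v \in K -> [set u; v] \in cycle_edges p ->
      (u, v) = (u1, v1) \/ (u, v) = (u2, v2)].
Proof.
move=> dRK cR cK u1R u2R v1K v2K e1 e2 ne.
have /connectP[p0 pp0] := cR _ _ u1R u2R.
case: (shortenP pp0) => p pp up _ eu2 {p0 pp0}.
have /connectP[q0 qq0] := cK _ _ v2K v1K.
case: (shortenP qq0) => q qq uq _ ev1 {q0 qq0}.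
have aR x : x \in u1 :: p -> x \in R.
  by rewrite inE => /orP[/eqP->//|]; apply: (allP (restr_path_all pp)).
have aK x : x \in v2 :: q -> x \in K.
  by rewrite inE => /orP[/eqP->//|]; apply: (allP (restr_path_all qq)).
have RK x : x \in R -> x \in K -> False.
  by move=> xR; rewrite (disjointFr dRK xR).
pose c := (u1 :: p) ++ (v2 :: q).
have uc : uniq c.
  rewrite cat_uniq up uq andbT; apply/hasPn => x xq.
  by apply/negP => xp; apply: (RK x); [apply: aR | apply: aK].
have rc : rot (size (u1 :: p)) c = (v2 :: q) ++ (u1 :: p) by rewrite rot_size_cat.
have uc' : uniq ((v2 :: q) ++ (u1 :: p)) by rewrite -rc rot_uniq.
have nextE x : next c x = next ((v2 :: q) ++ (u1 :: p)) x by rewrite -rc next_rot.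
have last1 x : last x (u1 :: p) = u2 by [].
have last2 x : last x (v2 :: q) = v1 by [].
have cyc : cycle (@edge G) c.
  rewrite /c /= rcons_cat cat_path (restr_path_edge pp) /= -eu2 e2 /=.
  by rewrite rcons_path (restr_path_edge qq) -ev1 edge_sym.
have cin x : x \in c -> (x \in R -> x \in u1 :: p) /\ (x \in K -> x \in v2 :: q).
  rewrite mem_cat => /orP[h|h]; split=> // h'; exfalso.
    exact: RK (aR _ h) h'.
  exact: RK h' (aK _ h).
exists c; split.
- split; first by rewrite /ucycle cyc.
  rewrite size_cat /= addnS ltnS addSn ltnS.
  case: p q eu2 ev1 ne {pp up qq uq aR aK c uc rc uc' nextE last1 last2 cyc cin}.
    by case=> //= <- <- ; rewrite eqxx.
  by [].
- apply/imsetP; exists v1; first by rewrite mem_cat ev1 mem_last orbT.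
  rewrite setUC; congr [set _; _]; move: uc.
  rewrite /c [v2 :: q]lastI -ev1 -cats1 catA => uc1.
  by rewrite (next_split uc1).
- apply/imsetP; exists u2; first by rewrite mem_cat eu2 mem_last.
  congr [set _; _]; move: uc.
  by rewrite /c [u1 :: p]lastI -eu2 cat_rcons => uc1; rewrite (next_split uc1).
move=> u v uR vK /imsetP[x xc /set2_inj[[ux vx]|[ux vx]]]; subst x.
  right; have [h _] := cin _ xc.
  have [|eu ev] := @next_cross R (u1 :: p) (v2 :: q) u uc aR (h uR).
    by rewrite [next _ _](_ : _ = v) //; apply/negP => /RK /(_ vK).
  by rewrite vx; congr (_, _); [exact: etrans eu (last1 u) | exact: ev].
left; have [_ h] := cin _ xc.
have [|ev eu] := @next_cross K (v2 :: q) (u1 :: p) v uc' aK (h vK).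
  by rewrite -nextE -ux; apply/negP; apply: RK.
by rewrite ux; congr (_, _); [rewrite nextE; exact: eu | exact: etrans ev (last2 v)].
Qed.

Lemma two_crossing_edges R K u1 v1 u2 v2 u3 v3 :
  cactus G -> [disjoint R & K] -> conn R -> conn K ->
  u1 \in R -> u2 \in R -> u3 \in R -> v1 \in K -> v2 \in K -> v3 \in K ->
  edge u1 v1 -> edge u2 v2 -> edge u3 v3 ->
  (u1, v1) != (u2, v2) -> (u1, v1) != (u3, v3) -> (u2, v2) = (u3, v3).
Proof.
move=> cG dRK cR cK u1R u2R u3R v1K v2K v3K e1 e2 e3 n12 n13.
have [p [cp mp mp2 hp]] := crossing_cycle dRK cR cK u1R u2R v1K v2K e1 e2 n12.
have [q [cq mq _ hq]] := crossing_cycle dRK cR cK u1R u3R v1K v3K e1 e3 n13.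
have epq := cG _ _ e1 _ _ cp cq mp mq.
move: mp2; rewrite epq => /(hq _ _ u2R v2K)[e|//].
by rewrite e eqxx in n12.
Qed.

End Cactus.

Ltac nlia :=
  repeat match goal with H : ?P |- _ =>
    lazymatch P with
    | is_true (leq _ _) => fail
    | is_true (andb _ _) => fail
    | @eq nat _ _ => fail
    | is_true (negb (@eq_op Datatypes_nat__canonical__eqtype_Equality _ _)) => fail
    | not (@eq nat _ _) => fail
    | not (is_true (andb _ _)) => fail
    | or (is_true (leq _ _)) _ => fail
    | _ => clear H
    end
  end; lia.

(* The shape, in a cactus, of a component [K] that is left of the live set [A]
   when the connected set [B] is removed: a path [y 0, ..., y m] whose ends
   are the only vertices adjacent to [B], every other vertex hanging at the
   vertex [y (idx v)] of that path. *)
Record spine (G : sgraph) (A B K : {set G}) (m : nat) (y : nat -> G)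
    (idx : G -> nat) : Prop := Spine {
  spine_mem : forall l, l <= m -> y l \in K;
  spine_idx : forall l, l <= m -> idx (y l) = l;
  spine_le : forall v, v \in K -> idx v <= m;
  spine_edge : forall u v, u \in K -> v \in K -> edge u v -> idx u < idx v ->
    [/\ idx v = (idx u).+1, u = y (idx u) & v = y (idx v)];
  spine_att : forall b v, b \in B -> v \in K -> edge b v -> v = y 0 \/ v = y m;
  spine_first : exists2 b, b \in B & edge b (y 0);
  spine_last : exists2 b, b \in B & edge b (y m);
  spine_step : forall l, l < m -> edge (y l) (y l.+1);
  spine_part : forall l, l <= m -> conn [set v in K | idx v == l];
  spine_sep : forall u v, u \in A -> v \in K -> edge u v -> (u \in B) || (u \in K)
}.

Section Spine.

Variable (G : sgraph).
Implicit Types (A B K D : {set G}) (u v : G).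

Lemma spine_rev A B K m y idx : spine A B K m y idx ->
  spine A B K m (fun l => y (m - l)) (fun v => m - idx v).
Proof.
case=> h1 h2 h3 h4 h5 h6 h7 h8 h9 h10; split=> //.
- by move=> l lm; apply: h1; nlia.
- by move=> l lm; rewrite h2; nlia.
- by move=> v _; nlia.
- move=> u v uK vK uv lt.
  have := h3 u uK; have := h3 v vK => vm um.
  rewrite edge_sym in uv; have [|e -> ->] := h4 v u vK uK uv; first by nlia.
  by rewrite !h2; [split=> //; try congr y; nlia | nlia | nlia].
- by move=> b v bB vK /(h5 _ _ bB vK); rewrite subn0 subnn; tauto.
- by rewrite subn0.
- by rewrite subnn.
- move=> l lm; rewrite edge_sym (_ : m - l = (m - l.+1).+1); last by nlia.
  by apply: h8; nlia.
- move=> l lm; have := h9 (m - l); rewrite leq_subr => /(_ isT).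
  congr conn; apply/setP => v; rewrite !inE; case vK: (v \in K) => //=.
  by have := h3 _ vK; nlia.
Qed.

Lemma spine_exists A B K e : cactus G -> conn B -> conn K ->
  [disjoint B & K] ->
  (forall u v, u \in A -> v \in K -> edge u v -> (u \in B) || (u \in K)) ->
  e \in K -> (exists2 b, b \in B & edge b e) ->
  exists m y idx, spine A B K m y idx.
Proof.
move=> cG cB cK dBK sepK eK [b1 b1B be1].
have BK u : u \in B -> u \in K -> False by move=> h; rewrite (disjointFr dBK h).
have [b2 [e2 [b2B e2K be2 att]]] : exists b2 e2,
    [/\ b2 \in B, e2 \in K, edge b2 e2 &
      forall b v, b \in B -> v \in K -> edge b v ->
        (b, v) = (b1, e) \/ (b, v) = (b2, e2)].
  have [[b2 [e2 [h1 h2 h3 ne]]]|no] := pselect (exists b2 e2,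
      [/\ b2 \in B, e2 \in K, edge b2 e2 & (b1, e) != (b2, e2)]).
    exists b2, e2; split=> // b v bB vK bv.
    have [->|n3] := eqVneq (b, v) (b1, e); first by left.
    right; rewrite eq_sym in n3.
    by rewrite (two_crossing_edges cG dBK cB cK b1B h1 bB eK h2 vK be1 h3 bv ne n3).
  exists b1, e; split=> // b v bB vK bv; left.
  have [->//|n3] := eqVneq (b, v) (b1, e).
  by case: no; exists b, v; rewrite eq_sym.
have /connectP[p0 pp0] := cK _ _ eK e2K.
case: (shortenP pp0) => p pp up _ ep {p0 pp0}.
pose Y := [set x in e :: p]; pose m := size p; pose y l := nth e (e :: p) l.
have YK : Y \subset K.
  apply/subsetP => x; rewrite !inE => /orP[/eqP->//|].
  exact: (allP (restr_path_all pp)).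
have [|h [hY hid hc]] := conn_partition cK YK.
  by apply/set0Pn; exists e; rewrite inE mem_head.
pose idx v := index (h v) (e :: p).
have y_mem l : l <= m -> y l \in Y by move=> lm; rewrite inE mem_nth.
have yK l : l <= m -> y l \in K by move=> /y_mem; apply: subsetP YK _.
have y_idx l : l <= m -> idx (y l) = l.
  by move=> lm; rewrite /idx hid ?y_mem // index_uniq.
have hE v : v \in K -> h v = y (idx v).
  by move=> /hY; rewrite inE => vY; rewrite /y nth_index.
have idx_le v : v \in K -> idx v <= m.
  by move=> /hY; rewrite inE -index_mem.
have step l : l < m -> edge (y l) (y l.+1).
  by move=> lm; have /(pathP e)/(_ _ lm) := restr_path_edge pp.
have hang D v : v \in K -> (forall u, u \in K -> idx u = idx v -> u \in D) ->
    connect (restr D) (y (idx v)) v.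
  move=> vK hD; rewrite -hE //; apply: connect_restr_mono (hc v vK).
  apply/subsetP => u; rewrite inE => /andP[uK /eqP e']; apply: hD => //.
  by rewrite /idx e'.
have chain D a k : a + k <= m -> (forall l, a <= l <= a + k -> y l \in D) ->
    connect (restr D) (y a) (y (a + k)).
  elim: k => [|k IH] akm hD; first by rewrite addn0 connect0.
  apply: connect_trans (IH _ _) _; first by nlia.
    by move=> l lk; apply: hD; nlia.
  by rewrite addnS; apply: connect_restr1; [apply: hD|apply: hD|apply: step]; nlia.
have lastE : e2 = y m by rewrite ep /y /m nth_last.
have y0E : y 0 = e by [].
clearbody m y idx; clear Y YK h hY hid hc y_mem hE p pp up ep.
exists m, y, idx; split=> //.
- move=> u v uK vK uv lt; have vm := idx_le _ vK; have um := idx_le _ uK.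
  pose R := B :|: [set w in K | idx w <= idx u].
  pose L := [set w in K | idx u < idx w].
  have cR : conn R.
    have BR : B \subset R by apply: subsetUl.
    apply: (@conn_center _ _ b1) => w; rewrite !inE => /orP[wB|/andP[wK wu]].
      exact: connect_restr_mono BR (cB _ _ b1B wB).
    have wm := idx_le _ wK.
    apply: connect_trans (hang _ _ wK _); last first.
      by move=> x xK xw; rewrite !inE xK xw wu orbT.
    have yR l : l <= idx u -> y l \in R.
      by move=> lu; rewrite !inE yK ?y_idx ?lu ?orbT //; nlia.
    apply: (@connect_trans _ _ (y 0)).
      by apply: connect_restr1; [rewrite inE b1B | exact: yR | rewrite y0E].
    by apply: (chain _ 0); [|move=> l lw; apply: yR]; nlia.
  have cL : conn L.
    apply: (@conn_center _ _ (y (idx u).+1)) => w; rewrite !inE => /andP[wK wu].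
    apply: connect_trans (hang _ _ wK _); last first.
      by move=> x xK xw; rewrite !inE xK xw wu.
    have wm := idx_le _ wK.
    rewrite -(subnKC wu); apply: chain; first by nlia.
    by move=> l lw; rewrite !inE yK ?y_idx //=; nlia.
  have dRL : [disjoint R & L].
    apply/pred0P => w /=; rewrite !inE; case wB: (w \in B) => /=.
      by rewrite (disjointFr dBK wB).
    by rewrite ltnNge; case: (w \in K) (idx w <= idx u) => -[].
  have y1 : y (idx u) \in R by rewrite !inE yK ?y_idx ?leqnn ?orbT //; nlia.
  have z1 : y (idx u).+1 \in L by rewrite !inE yK ?y_idx ?leqnn //; nlia.
  have ym : e2 \in L by rewrite lastE !inE yK ?y_idx //; nlia.
  have n12 : (y (idx u), y (idx u).+1) != (b2, e2).
    by apply/eqP => -[/esym e3 _]; apply: (BK b2) => //; rewrite e3 yK //; nlia.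
  have uR : u \in R by rewrite !inE uK leqnn orbT.
  have vL : v \in L by rewrite !inE vK lt.
  have bR : b2 \in R by rewrite !inE b2B.
  have [[e4 e5]|n13] := eqVneq (y (idx u), y (idx u).+1) (u, v).
    have iv : idx v = (idx u).+1 by rewrite -e5 y_idx //; nlia.
    by rewrite iv; split.
  have := two_crossing_edges cG dRL cR cL y1 bR uR z1 ym vL (step _ _) be2 uv n12 n13.
  move=> /(_ (leq_trans lt vm))[e6 _]; exfalso; apply: (BK b2) => //.
  by rewrite e6.
- move=> b v bB vK /(att _ _ bB vK)[[_ ->]|[_ ->]]; first by left.
  by right.
- by exists b1; rewrite ?y0E.
- by exists b2 => //; rewrite (_ : y m = e2) // ep /y /m nth_last.
- move=> l lm; apply: (@conn_center _ _ (y l)) => w; rewrite inE => /andP[wK /eqP<-].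
  by apply: hang => // x xK xw; rewrite inE xK xw eqxx.
Qed.

End Spine.

(** * The effect of a single firefighter *)

Section TailSum.

Variables (a : nat -> nat) (m s : nat).

Lemma initial_batch_le i n :
  \sum_(i <= j < n | \sum_(i <= l < j.+1) a l < s) a j <= s.
Proof.
elim: n => [|n IH]; first by rewrite big_geq.
have [ni|ni] := leqP i n; last by rewrite big_geq.
rewrite big_mkcond big_nat_recr //= -big_mkcond /=.
case: ifP => [h|_]; last by rewrite addn0.
apply: leq_trans (ltnW h); rewrite [leqRHS]big_nat_recr //= leq_add2r.
by rewrite [leqRHS](bigID (fun j => \sum_(i <= l < j.+1) a l < s)) leq_addr.
Qed.

Lemma tail_sum_step i i' n C : i <= i' ->
  (forall j, i <= j < n -> s <= \sum_(i <= l < j.+1) a l -> a j <= C) ->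
  \sum_(i <= j < n) a j <= s + (i' - i) * C + \sum_(i' <= j < n) a j.
Proof.
move=> ii' aC; rewrite (bigID (fun j => \sum_(i <= l < j.+1) a l < s)) -addnA /=.
apply: leq_add; first exact: initial_batch_le.
have nb k : k <= n ->
    \sum_(i <= j < k | ~~ (\sum_(i <= l < j.+1) a l < s)) a j <= (k - i) * C.
  move=> kn; rewrite -sum_nat_const_nat big_mkcond !big_nat; apply: leq_sum => j /andP[ij jk].
  by case: ifP => //; rewrite -leqNgt; apply: aC; rewrite ij (leq_trans jk kn).
have [ni|ni] := leqP n i'.
  apply: leq_trans (leq_addr _ _); apply: leq_trans (nb _ (leqnn _)) _.
  by rewrite leq_mul2r leq_sub2r ?orbT.
rewrite (big_cat_nat ii' (ltnW ni)) /=; apply: leq_add; first exact: nb (ltnW ni).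
by rewrite big_mkcond; apply: leq_sum => j _; case: ifP.
Qed.

Variables (t T k : nat).

(* [a j] is the weight hanging at the j-th vertex of a path along which the
   fire advances one vertex per round. The hypothesis is what maximality of
   the algorithm's score says: a weight that dominates at least [s] behind it
   for longer than the time [T] has to be exponentially smaller. *)
Hypothesis score_max : forall i j, i <= j <= m ->
  s <= \sum_(i <= l < j.+1) a l -> t + i + s * trunc_log 2 (a j) <= T + s * k.

Lemma tail_sum_le v u : v + u = k.+1 ->
  \sum_(T.+1 + u * s - s - t <= l < m.+1) a l + s <= s * (v + 2 ^ v.+1).
Proof.
elim: v u => [|v IH] u vu.
  have {vu} -> : u = k.+1 by lia.
  have h : forall j, T.+1 + k.+1 * s - s - t <= j < m.+1 ->
      s <= \sum_(T.+1 + k.+1 * s - s - t <= l < j.+1) a l -> a j <= 0.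
    by move=> j jm /score_max; lia.
  have := @tail_sum_step _ m.+1 m.+1 0 _ h.
  have [hm|hm] := leqP (T.+1 + k.+1 * s - s - t) m.+1; last first.
    by rewrite big_geq ?(ltnW hm) //; lia.
  by move=> /(_ isT); rewrite muln0 [X in _ <= _ + X]big_geq //; lia.
have h : forall j, T.+1 + u * s - s - t <= j < m.+1 ->
    s <= \sum_(T.+1 + u * s - s - t <= l < j.+1) a l -> a j <= 2 ^ v.+1.
  move=> j jm /score_max => /(_ ltac:(lia)) sj.
  have lv : trunc_log 2 (a j) <= v by nia.
  apply: ltnW; apply: leq_trans (trunc_log_ltn (a j) (isT : 1 < 2)) _.
  by rewrite leq_exp2l.
have := @tail_sum_step _ (T.+1 + u.+1 * s - s - t) m.+1 _ _ h.
have := IH u.+1 ltac:(lia).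
set S1 := \sum_(_ <= _ < _) _; set S0 := \sum_(_ <= _ < _) _.
rewrite [2 ^ v.+2]expnS => h1 /(_ ltac:(lia)) h2.
have : (T.+1 + u.+1 * s - s - t - (T.+1 + u * s - s - t)) * 2 ^ v.+1 <= s * 2 ^ v.+1.
  by rewrite leq_mul2r; apply/orP; right; lia.
by move: h1 h2; nia.
Qed.

Lemma tail_sum_le0 w : 0 < w -> k = trunc_log 2 w ->
  \sum_(T.+1 - s - t <= l < m.+1) a l + s <= 5 * s * w.
Proof.
move=> w0 kw; have := @tail_sum_le k.+1 0 (addn0 _); rewrite mul0n addn0.
move=> h; apply: leq_trans h _; rewrite -mulnA mulnCA leq_mul2l; apply/orP; right.
have := trunc_logP (isT : 1 < 2) w0; rewrite -kw !expnS => h2.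
have := ltn_expl k (isT : 1 < 2); lia.
Qed.

End TailSum.

Definition sep (G : sgraph) (r : G) (A X : {set G}) : {set G} :=
  A :\: reach r (A :\: X).

(* The last round before [L] (0 if there is none) in which a second firefighter
   could still enclose, together with one on [x], at least [s] vertices. *)
Definition delay (G : sgraph) (r : G) (s L : nat) (A : {set G}) (x : G) : nat :=
  \max_(t < L | [exists y in A :\: ball r (A :\ x) t,
                   s <= #|sep r A [set x; y]|]) t.

(* Doubling the weight saved at once is worth [s] rounds of delay: the delayed
   fire itself survives for at most [s] rounds off the cycle, because branches
   of weight [s] are protected at once. *)
Definition score (G : sgraph) (r : G) (s L : nat) (A : {set G}) (x : G) : nat :=
  delay r s L A x + s * trunc_log 2 #|sep r A [set x]|.

Section SpineFire.

Variables (G : sgraph) (r : G) (A K : {set G}) (t m : nat).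
Implicit Types (u v : G) (y : nat -> G) (idx : G -> nat).

Lemma card_idx_range idx i n :
  #|[set v in K | i <= idx v < n]| = \sum_(i <= l < n) #|[set v in K | idx v == l]|.
Proof.
elim: n => [|n IH].
  rewrite big_geq //; apply/eqP; rewrite cards_eq0.
  by apply/eqP/setP => v; rewrite !inE ltn0 !andbF.
have [ni|ni] := leqP i n; last first.
  rewrite big_geq //; apply/eqP; rewrite cards_eq0; apply/eqP/setP => v; rewrite !inE.
  by apply/negP => /and3P[_]; nlia.
rewrite big_nat_recr //= -IH -cardsUI [_ :&: _](_ : _ = set0); last first.
  by apply/setP => v; rewrite !inE; case: (v \in K) => //=; nlia.
rewrite cards0 addn0; congr #|pred_of_set _|; apply/setP => v; rewrite !inE.
by case: (v \in K) => //=; nlia.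
Qed.

Let B := ball r A t.

Hypotheses (rA : r \in A) (KA : K \subset A) (dBK : [disjoint B & K]).

Lemma ball_in v k (E : {set G}) : E \subset A -> v \in ball r E k -> v \in A.
Proof. by move=> /subsetP EA /ball_sub[->|/EA]. Qed.

Lemma rootK v : v \in K -> v <> r.
Proof. by move=> vK e; move/disjointFr: dBK => /(_ r); rewrite ball_root -e vK => /(_ isT). Qed.

Lemma inBK v : v \in B -> v \in K -> False.
Proof. by move=> h; rewrite (disjointFr dBK h). Qed.

Lemma arc_sep y idx i j : spine A B K m y idx -> i <= j <= m ->
  [set v in K | i <= idx v < j.+1] \subset sep r A [set y i; y j].
Proof.
case=> h1 h2 h3 h4 h5 h6 h7 h8 h9 h10 ijm.
suff h k v : v \in K -> i <= idx v < j.+1 -> v \notin ball r (A :\: [set y i; y j]) k.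
  apply/subsetP => v; rewrite inE => /andP[vK ij].
  rewrite inE (subsetP KA) // andbT; apply/reachP => -[k].
  exact/negP/h.
elim: k v => [|k IH] v vK ij; first by rewrite inE; apply/eqP/rootK.
apply/negP => /ballSP[|[]]; first exact/negP/IH.
rewrite !inE negb_or -andbA => /and3P[vi vj vA] [u uk uv].
have uA := ball_in (subsetDl _ _) uk.
have /orP[uB|uK] := h10 _ _ uA vK uv.
  case: (h5 _ _ uB vK uv) => ev; subst v.
    by have /eqP[] := vi; congr y; move: ij; rewrite h2 //; nlia.
  by have /eqP[] := vj; congr y; move: ij; rewrite h2 //; nlia.
have nij : ~ (i <= idx u < j.+1) by move=> /(IH _ uK); rewrite uk.
have [lt|le] := ltnP (idx u) (idx v).
  have [e _ ev] := h4 _ _ uK vK uv lt.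
  have iv : idx v = i by nlia.
  by rewrite -iv -ev eqxx in vi.
have lt : idx v < idx u by nlia.
rewrite edge_sym in uv; have [e ev _] := h4 _ _ vK uK uv lt.
have jv : idx v = j by nlia.
by rewrite -jv -ev eqxx in vj.
Qed.

Lemma fire_front y idx j k v : spine A B K m y idx -> k <= j <= m ->
  v \in K -> v \in ball r (A :\ y j) (t + k) -> idx v < k \/ j < idx v.
Proof.
case=> h1 h2 h3 h4 h5 h6 h7 h8 h9 h10.
elim: k v => [|k IH] v kjm vK.
  rewrite addn0 => /(subsetP (ball_mono r t (subsetDl _ _))) vB.
  by case: (inBK vB vK).
rewrite addnS => /ballSP[/(IH _ _ vK)|[]]; first by nlia.
rewrite !inE => /andP[vj vA] [u uk uv].
have uA := ball_in (subsetDl _ _) uk.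
have /orP[uB|uK] := h10 _ _ uA vK uv.
  case: (h5 _ _ uB vK uv) => ev; subst v; first by rewrite h2 //; left.
  rewrite h2 //; right; have : j <> m by move=> e; rewrite e eqxx in vj.
  by nlia.
have := IH _ _ uK uk; move=> /(_ ltac:(nlia)) hu.
have [lt|le] := ltnP (idx u) (idx v).
  by have [e _ _] := h4 _ _ uK vK uv lt; nlia.
have [//|lt] := leqP (idx u) (idx v); first by nlia.
rewrite edge_sym in uv; have [e ev _] := h4 _ _ vK uK uv lt.
have : idx v <> j by move=> jv; rewrite -jv -ev eqxx in vj.
by nlia.
Qed.

Lemma fire_progress y idx x v : spine A B K m y idx -> x \in K -> v \in K ->
  idx v < idx x ->
  v \in ball r (A :\ x) (t + idx v + #|[set u in K | idx u == idx v]|).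
Proof.
case=> h1 h2 h3 h4 h5 h6 h7 h8 h9 h10 xK vK lt.
have xm := h3 _ xK.
have Bx : ball r (A :\ x) t = B.
  rewrite ball_setD //; rewrite disjoints1; apply/negP => xB; exact: inBK xB xK.
have yx l : l < idx x -> y l \in A :\ x.
  move=> lx; rewrite !inE (subsetP KA) ?h1 ?andbT; try by nlia.
  by apply/eqP => e; have := h2 l ltac:(nlia); rewrite e; nlia.
have yl l : l < idx x -> y l \in ball r (A :\ x) (t + l.+1).
  elim: l => [|l IH] lx.
    case: h6 => b bB be; rewrite addn1; apply: ball_step be; last exact: yx.
    by rewrite Bx.
  rewrite addnS; apply: (ball_step (IH _) (yx _ lx) (h8 _ _)); nlia.
have cK := h9 _ (h3 _ vK).
have := @ball_connected_grow _ r (A :\ x) _ (y (idx v)) (t + (idx v).+1) cK.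
rewrite inE h1 ?h2 ?eqxx; try by nlia.
move=> /(_ isT _ (yl _ lt)) h.
rewrite addnS addSn /= in h; apply: (subsetP (h _)); last by rewrite inE vK eqxx.
apply/subsetP => u; rewrite !inE => /andP[uK /eqP e]; rewrite (subsetP KA) // andbT.
by apply/eqP => ex; rewrite -ex e ltnn in lt.
Qed.

Variables (s L : nat) (x : G).
Hypotheses (Lbig : t + #|G| <= L)
  (small : forall v, v \in A :\: B -> #|sep r A [set v]| < s)
  (xAB : x \in A :\: B)
  (x_max : forall v, v \in A :\: B -> score r s L A v <= score r s L A x).

Lemma left_delayed_le y idx x' t2 : spine A B K m y idx -> x' \in K ->
  delay r s L A x < t2 ->
  #|[set v in K | (idx v < idx x') && (v \notin ball r (A :\ x') t2)]| + s
    <= 5 * s * #|sep r A [set x]|.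
Proof.
move=> spK x'K dt2; case: (spK) => h1 h2 h3 h4 h5 h6 h7 h8 h9 h10.
pose a l := #|[set v in K | idx v == l]|.
have yAB l : l <= m -> y l \in A :\: B.
  move=> lm; rewrite inE (subsetP KA) ?h1 // andbT; apply/negP => yB.
  exact: inBK yB (h1 _ lm).
have a_le l : l <= m -> a l <= #|sep r A [set y l]|.
  move=> lm; have := @arc_sep y idx l l spK; rewrite leqnn lm setUid => /(_ isT) h.
  apply: leq_trans (subset_leq_card h); apply: subset_leq_card.
  apply/subsetP => v; rewrite !inE => /andP[-> /eqP->] /=; nlia.
have a_lt l : l <= m -> a l < s.
  by move=> lm; apply: leq_ltn_trans (a_le _ lm) (small (yAB _ lm)).
have mG : m < #|G|.
  have inj : injective (fun i : 'I_m.+1 => y i).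
    move=> i j /(congr1 idx); rewrite !h2 ?leq_ord //; exact: val_inj.
  by have := leq_card _ inj; rewrite card_ord.
have w0 : 0 < #|sep r A [set x]|.
  apply/card_gt0P; exists x; move: xAB; rewrite !inE => /andP[xB ->]; rewrite andbT.
  apply/negP => /asboolP/reachP/reach_sub[e|]; last by rewrite !inE eqxx.
  by rewrite e ball_root in xB.
have sc i j : i <= j <= m -> s <= \sum_(i <= l < j.+1) a l ->
    t + i + s * trunc_log 2 (a j) <= delay r s L A x + s * trunc_log 2 #|sep r A [set x]|.
  move=> ijm; rewrite -card_idx_range => sij.
  have jm : j <= m by case/andP: ijm.
  apply: leq_trans (x_max (yAB _ jm)).
  apply: leq_add; last by rewrite leq_mul2l leq_trunc_log ?orbT ?a_le.
  have tiL : t + i < L by nlia.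
  apply: (@leq_bigmax_cond _ _ _ (Ordinal tiL)).
  apply/existsP; exists (y i); apply/andP; split; last first.
    rewrite setUC; apply: leq_trans sij _.
    exact: subset_leq_card (arc_sep spK ijm).
  have im : i <= m by nlia.
  rewrite inE (subsetP KA) ?h1 // andbT; apply/negP => /= yi.
  have := @fire_front y idx j i (y i) spK ijm (h1 _ im) yi.
  by rewrite h2 //; nlia.
apply: leq_trans (tail_sum_le0 sc w0 erefl).
rewrite leq_add2r -card_idx_range; apply: subset_leq_card; apply/subsetP => v.
rewrite !inE => /and3P[vK vx vb]; rewrite vK ltnS h3 // andbT /=.
rewrite leqNgt; apply/negP => lt; move/negP: vb; apply.
apply: subsetP (fire_progress spK x'K vK vx); apply: ball_le.
have := a_lt _ (h3 _ vK); rewrite /a; nlia.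
Qed.

End SpineFire.

Section Component.

Variables (G : sgraph) (r : G) (A : {set G}) (t : nat) (x' : G).
Let B := ball r A t.
Let C := comp (A :\: B) x'.
Hypotheses (cG : cactus G) (rA : r \in A) (cA : conn A) (x'AB : x' \in A :\: B).

Lemma comp_unburnt_sub : C \subset A.
Proof. exact: subset_trans (comp_sub x'AB) (subsetDl _ _). Qed.

Lemma comp_unburnt_disjoint : [disjoint B & C].
Proof.
rewrite disjoint_sym disjoint_subset; apply: subset_trans (comp_sub x'AB) _.
by apply/subsetP => v; rewrite !inE => /andP[].
Qed.

Lemma comp_unburnt_sep u v : u \in A -> v \in C -> edge u v ->
  (u \in B) || (u \in C).
Proof.
move=> uA vC uv; case uB : (u \in B) => //=.
apply: (@comp_step _ (A :\: B) x' v u); [|by rewrite !inE uA uB|by rewrite edge_sym|by []].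
exact: subsetP (comp_sub x'AB) _ vC.
Qed.

Lemma comp_spine : exists m y idx, spine A B C m y idx.
Proof.
have x'C : x' \in C by apply: comp_root.
have rC : r \notin C by rewrite (disjointFr comp_unburnt_disjoint (ball_root r A t)).
have [e [b [eA bA eC bC eb]]] :=
  conn_exit cA (subsetP comp_unburnt_sub _ x'C) rA x'C rC.
rewrite edge_sym in eb.
have bB : b \in B by have := comp_unburnt_sep bA eC eb; rewrite (negbTE bC) orbF.
apply: (@spine_exists _ A B C e cG) => //; first exact: ball_conn.
- exact: comp_conn.
- exact: comp_unburnt_disjoint.
- exact: comp_unburnt_sep.
- by exists b.
Qed.

Lemma comp_unburnt_lt s :
  (forall p q, p \in A :\: B -> q \in A :\: B -> #|sep r A [set p; q]| < s) ->
  #|C| < s.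
Proof.
move=> small; have [m [y [idx spC]]] := comp_spine.
have yAB l : l <= m -> y l \in A :\: B.
  by move=> /(spine_mem spC); apply: subsetP (comp_sub x'AB) _.
apply: leq_ltn_trans (small _ _ (yAB 0 _) (yAB m _)) => //.
have := arc_sep rA comp_unburnt_sub comp_unburnt_disjoint spC (i := 0) (j := m).
rewrite leqnn => /(_ isT) /subset_leq_card; apply: leq_trans.
apply: subset_leq_card; apply/subsetP => v vC.
by rewrite in_set vC ltnS (spine_le spC vC).
Qed.

Lemma delayed_le s L x t2 : t + #|G| <= L ->
  (forall v, v \in A :\: B -> #|sep r A [set v]| < s) ->
  x \in A :\: B ->
  (forall v, v \in A :\: B -> score r s L A v <= score r s L A x) ->
  delay r s L A x < t2 ->
  #|C :\: ball r (A :\ x') t2| <= 10 * s * #|sep r A [set x]|.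
Proof.
move=> Lbig small xAB x_max dt2; have [m [y [idx spC]]] := comp_spine.
have x'C : x' \in C by apply: comp_root.
have CAB : C \subset A :\: B by apply: comp_sub.
have [CA dBC] := (comp_unburnt_sub, comp_unburnt_disjoint).
have := left_delayed_le rA CA dBC Lbig small xAB x_max spC x'C dt2.
have := left_delayed_le rA CA dBC Lbig small xAB x_max (spine_rev spC) x'C dt2.
have ym := spine_le spC x'C; clearbody C.
set S1 := [set _ in _ | _]; set S2 := [set _ in _ | _] => c1 c2.
have := arc_sep rA CA dBC spC (i := idx x') (j := idx x').
rewrite leqnn ym setUid => /(_ isT).
set S3 := [set _ in _ | _] => /subset_leq_card c3.
have {}c3 : #|S3| < s.
  apply: leq_ltn_trans c3 (small _ _); apply: subsetP CAB _ _.
  exact: spine_mem spC _ ym.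
have : C :\: ball r (A :\ x') t2 \subset S1 :|: S2 :|: S3.
  apply/subsetP => v; rewrite !inE => /andP[-> vC]; rewrite vC !andbT /=.
  by have := spine_le spC vC; nlia.
move=> /subset_leq_card h; apply: leq_trans h _.
have := cardsU (S1 :|: S2) S3; have := cardsU S1 S2; nlia.
Qed.

End Component.

(** * Replacing one move of a strategy by another *)

Section Plan.

Variables (G : sgraph) (r : G).
Implicit Types (A E K X : {set G}) (S : nat -> {set G}) (u v : G).

Definition placed S t j : {set G} := [set v | `[< exists2 l, t <= l < j & v \in S l >]].

Definition placed_from S t : {set G} := [set v | `[< exists2 l, t <= l & v \in S l >]].

Lemma placedP S t j v : reflect (exists2 l, t <= l < j & v \in S l) (v \in placed S t j).
Proof. by rewrite inE; apply: asboolP. Qed.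

Lemma placed_fromP S t v : reflect (exists2 l, t <= l & v \in S l) (v \in placed_from S t).
Proof. by rewrite inE; apply: asboolP. Qed.

Lemma placed0 S t : placed S t t = set0.
Proof. by apply/setP => v; rewrite [RHS]inE; apply/placedP => -[l tl _]; nlia. Qed.

Lemma placed_sub S t j : placed S t j \subset placed_from S t.
Proof.
by apply/subsetP => v /placedP[l /andP[tl _] vl]; apply/placed_fromP; exists l.
Qed.

(* A continuation, from round [t] on, of a game whose live vertices (those
   that burn unless more of them get protected) form the set [A]. *)
Definition plan A t (f : nat -> nat) S : Prop := forall j, t <= j ->
  [/\ #|S j| <= f j, S j \subset A & [disjoint S j & ball r (A :\: placed S t j) j]].

Lemma placed_disjoint E S t :
  (forall j, t <= j -> [disjoint S j & ball r (E :\: placed S t j) j]) ->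
  [disjoint placed_from S t & ball r E t].
Proof.
move=> dS; suff h j : [disjoint placed S t j & ball r E t].
  apply/pred0P => v /=; apply/negP => /andP[/placed_fromP[l tl vl] vE].
  have /(disjointFl (h l.+1)) := vE => /placedP[].
  by exists l => //; rewrite tl ltnSn.
elim: j => [|j IH].
  by apply/pred0P => v /=; apply/negP => /andP[/placedP[l]]; rewrite ltn0 andbF.
apply/pred0P => v /=; apply/negP => /andP[/placedP[l /andP[tl lj] vl] vE].
have [e|lj'] := eqVneq l j; last first.
  have /(disjointFl IH)/placedP[] := vE; exists l => //.
  by nlia.
subst l; have /(disjointFr (dS _ tl)) := vl.
rewrite (subsetP (ball_le _ _ tl)) //.
by rewrite ball_setD.
Qed.

Lemma ball_outside A K X t j v : r \in A -> K \subset A ->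
  [disjoint ball r A t & K] ->
  (forall u v, u \in A -> v \in K -> edge u v -> (u \in ball r A t) || (u \in K)) ->
  [disjoint X & ball r A t] -> t <= j -> v \notin K ->
  v \in ball r (A :\: (X :\: K)) j -> v \in ball r (A :\: X) j.
Proof.
move=> rA KA dBK sepK dX /subnKC<-; elim: (j - t) v => [|k IH] v vK.
  rewrite addn0 !ball_setD //; apply: disjointWl dX; exact: subsetDl.
rewrite addnS => /ballSP[/(IH _ vK) ?|[vD [u uk uv]]]; first by apply/ballSP; left.
move: vD; rewrite !in_setD vK /= => /andP[vX vA].
have [uK|uK] := boolP (u \in K); last first.
  by apply: (ball_step (IH _ uK uk) _ uv); rewrite inE vX.
rewrite edge_sym in uv; have /orP[vB|] := sepK _ _ vA uK uv; last by rewrite (negbTE vK).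
apply: (subsetP (@ball_le _ r _ t _ _)); first by nlia.
by rewrite ball_setD.
Qed.

(* Damage control: if the vertices protected in round [t] by a plan only
   influence [K], then outside of [K] the rest of the plan can still be
   followed after any other move [X]. *)
Lemma plan_switch A K X t t2 f S c : r \in A -> plan A t f S -> K \subset A ->
  [disjoint ball r A t & K] ->
  (forall u v, u \in A -> v \in K -> edge u v -> (u \in ball r A t) || (u \in K)) ->
  S t \subset K -> t < t2 -> (forall j, t < j < t2 -> f j = 0) ->
  #|K :\: ball r (A :\: S t) t2| <= c ->
  exists2 S', plan (reach r (A :\: X)) t2 f S' &
    #|sep r A (placed_from S t)| <=
      c + #|A :\: reach r (A :\: X)| +
      #|sep r (reach r (A :\: X)) (placed_from S' t2)|.
Proof.
move=> rA pS KA dBK sepK SK lt f0 cK; set A' := reach r (A :\: X).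
have A'A : A' \subset A.
  by apply/subsetP => v /reach_sub[->//|]; rewrite inE => /andP[].
have S0 j : t < j < t2 -> S j = set0.
  move=> tj; apply/eqP; rewrite -cards_eq0 -leqn0 -(f0 _ tj).
  by case: (pS j); [move: tj; nlia | ].
have dP : [disjoint placed_from S t & ball r A t].
  by apply: placed_disjoint => j /pS[].
pose S' j := (S j :\: K) :&: A'.
have plS' j v : v \in A' -> v \notin placed S' t2 j -> v \notin placed S t j :\: K.
  move=> vA vn; rewrite inE; apply/negP => /andP[vK /placedP[l /andP[tl lj] vl]].
  move/negP: vn; apply; apply/placedP; exists l; last by rewrite in_setI in_setD vK vl vA.
  rewrite lj andbT leqNgt; apply/negP => lt2.
  have [e|ne] := eqVneq l t.
    by subst l; rewrite (subsetP SK) in vK.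
  by rewrite S0 ?inE // in vl; nlia.
have ballS' j : ball r (A' :\: placed S' t2 j) j \subset ball r (A :\: (placed S t j :\: K)) j.
  apply: ball_mono; apply/subsetP => v; rewrite inE => /andP[vn vA'].
  by rewrite inE (subsetP A'A) // andbT; apply: plS'.
exists S'.
  move=> j tj; have [h1 h2 h3] := pS j (ltnW (leq_trans lt tj)); split.
  - apply: leq_trans h1; apply: subset_leq_card.
    by apply: subset_trans (subsetIl _ _) (subsetDl _ _).
  - exact: subsetIr.
  - apply/pred0P => v /=; apply/negP => /andP[]; rewrite inE inE => /andP[/andP[vK vS] _].
    move=> /(subsetP (ballS' j)) vb; move/disjointFr: h3 => /(_ _ vS)/negP[].
    apply: (ball_outside rA KA dBK sepK _ _ vK vb); last by nlia.
    exact: disjointWl (placed_sub _ _ _) dP.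
have sub : sep r A (placed_from S t) \subset
    (K :\: ball r (A :\: S t) t2) :|: (A :\: A') :|: sep r A' (placed_from S' t2).
  apply/subsetP => v; rewrite !inE; case vA: (v \in A); rewrite ?andbF // !andbT.
  move=> /asboolP vr.
  have [vK|vK] := boolP (v \in K).
    rewrite andbT; apply/orP; left; apply/orP; left; apply/negP => vt.
    apply: vr; exists t2.
    have dP2 : [disjoint placed_from S t2 & ball r (A :\: S t) t2].
      apply: placed_disjoint => j tj; have [_ _] := pS j (ltnW (leq_trans lt tj)).
      apply: disjointWr; apply: ball_mono; apply/subsetP => u; rewrite !inE.
      move=> /and3P[un ut uA]; rewrite uA andbT; apply/asboolP => -[l /andP[tl lj] ul].
      have [e|ne] := eqVneq l t; first by subst l; rewrite ul in ut.
      have [l2|l2] := ltnP l t2.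
        by rewrite S0 ?inE // in ul; nlia.
      by move/asboolP: un; apply; exists l => //; rewrite l2.
    rewrite -(ball_setD dP2) in vt;  apply: (subsetP (ball_mono _ _ _) _ vt).
    apply/subsetP => u; rewrite !inE => /and3P[un ut uA]; rewrite uA andbT.
    apply/asboolP => -[l tl ul].
    have [e|ne] := eqVneq l t; first by subst l; rewrite ul in ut.
    have [l2|l2] := ltnP l t2.
      by rewrite S0 ?inE // in ul; nlia.
    by move/asboolP: un; apply; exists l.
  rewrite andbF /=; case: asboolP => //= vA'; rewrite andbT.
  apply/asboolP => -[k vk]; apply: vr; exists (maxn t k).
  apply: (ball_outside rA KA dBK sepK dP (leq_maxl _ _) vK).
  apply: (subsetP (ball_le _ _ (leq_maxr t k))); apply: (subsetP (ball_mono _ _ _) _ vk).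
  apply/subsetP => u; rewrite inE => /andP[un uA']; rewrite inE (subsetP A'A) // andbT.
  rewrite inE; apply/negP => /andP[uK /placed_fromP[l tl ul]].
  have upl : u \in placed S t l.+1 :\: K.
    by rewrite in_setD uK; apply/placedP; exists l => //; rewrite tl ltnSn.
  have /negPn/placedP[i /andP[ti _] ui] := contraL (plS' l.+1 u uA') upl.
  by move/negP: un; apply; apply/placed_fromP; exists i.
apply: leq_trans (subset_leq_card sub) _.
apply: leq_trans (leq_card_setU _ _) _; rewrite leq_add2r.
by apply: leq_trans (leq_card_setU _ _) _; rewrite leq_add2r.
Qed.

End Plan.

(** * The online algorithm *)

Lemma exists_subset_card (T : finType) (D : {set T}) k : k <= #|D| ->
  exists2 X : {set T}, X \subset D & #|X| = k.
Proof.
move=> kD; exists [set x in take k (enum D)].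
  by apply/subsetP => x; rewrite inE => /mem_take; rewrite mem_enum.
rewrite cardsE; have /card_uniqP -> : uniq (take k (enum D)).
  by apply: take_uniq; apply: enum_uniq.
by rewrite size_takel // -cardE.
Qed.

Lemma burning_ball (G : sgraph) (r : G) (S : nat -> {set G}) i :
  (forall j, j < i -> [disjoint S j & burning r S j]) ->
  burning r S i = ball r (~: protected S i) i.
Proof.
elim: i => [//|i IH] dS.
have Bi : burning r S i = ball r (~: protected S i) i.
  by apply: IH => j ji; apply: dS; apply: ltnW.
have e : ball r (~: protected S i.+1) i = ball r (~: protected S i) i.
  rewrite /protected big_ord_recr /= setCU -setDE ball_setD // -Bi.
  exact: dS.
rewrite /= Bi; apply/setP => v; apply/idP/ballSP.
  rewrite e !inE => /orP[|/andP[vP /existsP[u /andP[ub uv]]]]; first by left.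
  by right; split=> //; exists u.
rewrite e !inE => -[->//|[vP [u ub uv]]]; apply/orP; right.
by rewrite vP; apply/existsP; exists u; rewrite ub.
Qed.

Lemma reach_idem (G : sgraph) (r : G) (D : {set G}) : reach r (reach r D) = reach r D.
Proof. by rewrite -[X in reach r X]setD0 reach_reachD setD0. Qed.

Lemma sqrt_bounds n : Nat.sqrt n * Nat.sqrt n <= n < (Nat.sqrt n).+1 * (Nat.sqrt n).+1.
Proof. have := PeanoNat.Nat.sqrt_spec n (PeanoNat.Nat.le_0_l n); lia. Qed.

Section Algorithm.

Variables (G : sgraph) (r : G).
Implicit Types (A X : {set G}).

Let A0 := reach r [set: G].
Definition goal : nat := Nat.sqrt #|G|.
Definition horizon : nat := 2 * #|G|.

Definition winning A X : bool := goal <= #|A0 :\: reach r (A :\: X)|.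

Definition affordable A t k X : bool := (X \subset A :\: ball r A t) && (#|X| <= k).

Definition best A t x : bool :=
  [forall v in A :\: ball r A t, score r goal horizon A v <= score r goal horizon A x].

Definition good_move A t k X : bool :=
  affordable A t k X &&
  (winning A X ||
   [&& ~~ [exists X', affordable A t k X' && winning A X'],
       #|X| == minn k #|A :\: ball r A t| &
       (k == 1) ==> [forall x in X, best A t x]]).

Definition move A t k : {set G} := odflt set0 [pick X | good_move A t k X].

Lemma moveP A t k : good_move A t k (move A t k).
Proof.
rewrite /move; case: pickP => //= no; exfalso.
have [/existsP[X /andP[aX wX]]|nw] :=
    boolP [exists X', affordable A t k X' && winning A X'].
  by have := no X; rewrite /good_move aX wX.
suff [X aX [cX bX]] : exists2 X, affordable A t k X &
    #|X| = minn k #|A :\: ball r A t| /\ (k == 1 -> forall x, x \in X -> best A t x).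
  have := no X; rewrite /good_move aX nw cX eqxx /= => /negP[].
  apply/orP; right; apply/implyP => /bX h; apply/forallP => x; apply/implyP; exact: h.
have [k1|k1] := boolP ((k == 1) && (0 < #|A :\: ball r A t|)); last first.
  have [X XD cX] := exists_subset_card (geq_minr k #|A :\: ball r A t|).
  exists X; first by rewrite /affordable XD cX geq_minl.
  split=> // e x xX; move: k1; rewrite e /= -leqNgt leqn0 => /eqP c0.
  by move: cX; rewrite c0 minn0 => /eqP; rewrite cards_eq0 => /eqP X0; rewrite X0 inE in xX.
case/andP: k1 => /eqP-> pos; have /card_gt0P[x0 x0D] := pos.
case: (arg_maxnP (score r goal horizon A) x0D) => x xD xmax.
exists [set x]; first by rewrite /affordable sub1set cards1 andbT; exact: xD.
split; first by rewrite cards1 (minn_idPl pos).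
move=> _ y /set1P->; apply/forallP => v; apply/implyP; exact: xmax.
Qed.

Fixpoint state (f : nat -> nat) i : {set G} :=
  if i is j.+1 then reach r (state f j :\: move (state f j) j (f j)) else A0.

Lemma state_eq f g i : (forall j, j < i -> f j = g j) -> state f i = state g i.
Proof.
elim: i => //= i IH fg; rewrite IH ?fg // => j ji; apply: fg; exact: ltnW.
Qed.

Definition next_move (sq : seq nat) : {set G} :=
  let i := (size sq).-1 in move (state (nth 0 sq) i) i (nth 0 sq i).

Lemma next_moveE f i : next_move (mkseq f i.+1) = move (state f i) i (f i).
Proof.
rewrite /next_move size_mkseq /= nth_mkseq //.
rewrite (@state_eq _ f) // => j ji; rewrite nth_mkseq //; exact: ltnW.
Qed.

Lemma root_state f i : r \in state f i.
Proof. by case: i => [|i]; apply: reach_root. Qed.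

Lemma reach_state f i : reach r (state f i) = state f i.
Proof. by case: i => [|i]; apply: reach_idem. Qed.

Lemma state_step_sub f i : state f i.+1 \subset state f i.
Proof.
apply/subsetP => v /reach_sub[->|]; first exact: root_state.
by rewrite inE => /andP[].
Qed.

Lemma state_anti f i j : i <= j -> state f j \subset state f i.
Proof.
move=> /subnKC<-; elim: (j - i) => [|k IH]; first by rewrite addn0.
by rewrite addnS; apply: subset_trans (state_step_sub _ _) IH.
Qed.

Variable f : nat -> nat.
Let S i := next_move (mkseq f i.+1).

Lemma state_protected i : state f i = reach r (~: protected S i).
Proof.
elim: i => [|i IH] /=; first by rewrite /protected big_ord0 setC0.
by rewrite -next_moveE IH reach_reachD /protected big_ord_recr /= setCU setDE.
Qed.

Lemma move_affordable i : affordable (state f i) i (f i) (S i).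
Proof. by rewrite /S next_moveE; case/andP: (moveP (state f i) i (f i)). Qed.

Lemma next_move_disjoint i : [disjoint S i & burning r S i].
Proof.
elim/ltn_ind: i => i IH; rewrite burning_ball //.
have /andP[sub _] := move_affordable i.
rewrite disjoint_subset; apply: subset_trans sub _; apply/subsetP => v.
rewrite inE => /andP[vb _]; rewrite inE; move: vb; rewrite state_protected.
by rewrite -[X in ball r X i]setD0 ball_reachD setD0.
Qed.

Lemma burning_state i : burning r S i = ball r (state f i) i.
Proof.
rewrite burning_ball; last by move=> j _; apply: next_move_disjoint.
by rewrite state_protected -[in RHS](setD0 (reach _ _)) ball_reachD setD0.
Qed.

Lemma next_move_legal : legal r f S.
Proof.
move=> i; have /andP[sub le] := move_affordable i; split=> //.
rewrite -setI_eq0 setIUr setU_eq0 !setI_eq0 next_move_disjoint /=.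
rewrite disjoint_subset; apply: subset_trans sub _; apply/subsetP => v.
rewrite inE => /andP[vb]; rewrite state_protected => /reach_sub[e|]; last by rewrite inE.
by move: vb; rewrite e ball_root.
Qed.

Lemma burning_le (T : nat -> {set G}) i j : i <= j -> burning r T i \subset burning r T j.
Proof.
move=> /subnKC<-; elim: (j - i) => [|k IH]; first by rewrite addn0.
by rewrite addnS; apply: subset_trans IH (subsetUl _ _).
Qed.

Lemma saved_ge i : #|~: state f i| <= #|saved r S|.
Proof.
apply: subset_leq_card; apply/subsetP => v; rewrite !inE => vs.
apply/asboolP => j; apply/negP => vj.
have : v \in burning r S (maxn i j) by apply: subsetP vj; apply/burning_le/leq_maxr.
rewrite burning_state => /ball_sub[e|]; first by rewrite e root_state in vs.
by move=> /(subsetP (state_anti _ (leq_maxl _ _))); rewrite (negbTE vs).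
Qed.

End Algorithm.

Section Competitive.

Variables (G : sgraph) (r : G) (f : nat -> nat).
Hypothesis cG : cactus G.
Let A i := state r f i.
Let s := goal G.
Let L := horizon G.
Let X i := move r (A i) i (f i).
Let B i := ball r (A i) i.

Lemma goal_gt0 : 0 < s.
Proof.
have n0 : 0 < #|G| by apply/card_gt0P; exists r.
by have := sqrt_bounds #|G|; rewrite /s /goal; case: Nat.sqrt => //; nlia.
Qed.

Lemma move_sub i : X i \subset A i :\: B i.
Proof. by case/andP: (moveP r (A i) i (f i)) => /andP[]. Qed.

Lemma card_move_le i : #|X i| <= #|A i :\: A i.+1|.
Proof.
apply: subset_leq_card; apply/subsetP => x xX.
have := subsetP (move_sub i) _ xX; rewrite in_setD => /andP[xB xA].
rewrite in_setD xA andbT; apply/negP => /reach_sub[e|]; last by rewrite in_setD xX.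
by rewrite e ball_root in xB.
Qed.

Lemma idle_state i j : i <= j -> (forall k, i <= k < j -> f k = 0) -> A j = A i.
Proof.
move=> /subnKC<-; elim: (j - i) => [|k IH] f0; first by rewrite addn0.
rewrite addnS /A /= -/(A _) IH; last by move=> l il; apply: f0; nlia.
have : #|move r (A i) (i + k) (f (i + k))| <= 0.
  rewrite -[X in _ <= X](f0 (i + k)); last by nlia.
  by case/andP: (moveP r (A i) (i + k) (f (i + k))) => /andP[].
by rewrite leqn0 cards_eq0 => /eqP->; rewrite setD0 reach_state.
Qed.

Hypothesis lost : #|A 0 :\: A L| < s.

Lemma card_gain i j k : i <= j <= k -> #|A i :\: A k| = #|A i :\: A j| + #|A j :\: A k|.
Proof.
move=> /andP[ij jk]; rewrite -cardsUI [X in _ = _ + #|pred_of_set X|](_ : _ = set0).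
  rewrite cards0 addn0; congr #|pred_of_set _|; apply/setP => v; rewrite !in_setU !in_setD.
  case: (boolP (v \in A k)) => [vk|_] /=; first by rewrite (subsetP (state_anti r f jk) _ vk).
  by case: (boolP (v \in A j)) => [/(subsetP (state_anti r f ij))-> //|_]; rewrite orbF.
by apply/setP => v; rewrite !inE; case: (v \in A j); rewrite ?andbF.
Qed.

Lemma not_winning i : i < L -> ~~ winning r (A i) (X i).
Proof.
move=> iL; rewrite /winning -ltnNge; apply: leq_ltn_trans lost.
apply: subset_leq_card; apply: setDS; exact: (state_anti r f iL).
Qed.

Lemma not_winnable i Y : i < L -> affordable r (A i) i (f i) Y -> ~~ winning r (A i) Y.
Proof.
move=> iL aY; case/andP: (moveP r (A i) i (f i)) => _.
rewrite (negbTE (not_winning iL)) => /and3P[/existsPn/(_ Y)].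
by rewrite aY.
Qed.

Lemma not_winnable_sep i Y : i < L -> affordable r (A i) i (f i) Y ->
  #|sep r (A i) Y| < s.
Proof.
move=> iL /(not_winnable iL); rewrite /winning -ltnNge; apply: leq_ltn_trans.
apply: subset_leq_card; apply: setSD; exact: (state_anti r f (leq0n i)).
Qed.

Lemma delay_lt i t2 x : i < t2 <= L -> (forall j, i < j < t2 -> f j = 0) ->
  f t2 <> 0 \/ t2 = L -> X i = [set x] -> delay r s L (A i) x < t2.
Proof.
move=> /andP[it t2L] f0 ft2 Xx.
have t20 : 0 < t2 by nlia.
rewrite -[t2]prednK // ltnS; apply/bigmax_leqP => -[t tL] /= /existsP[y /andP[yD sy]].
rewrite -ltnS prednK // ltnNge; apply/negP => t2t.
have {}ft2 : f t2 <> 0 by case: ft2 => // e; nlia.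
have {}t2L : t2 < L by nlia.
have At2 : A t2 = A i.+1 by apply: idle_state => // k ik; apply: f0; nlia.
have Ai1 : A i.+1 = reach r (A i :\ x) by rewrite -Xx.
have aff : affordable r (A t2) t2 (f t2) ([set y] :&: A t2).
  apply/andP; split.
    apply/subsetP => z; rewrite in_setI in_setD => /andP[/set1P-> ->]; rewrite andbT.
    rewrite At2 Ai1 -[X in ball r X](setD0 (reach _ _)) ball_reachD setD0.
    move: yD; rewrite in_setD => /andP[yn _]; apply: contra yn.
    exact/subsetP/ball_le.
  apply: (@leq_trans 1); last by rewrite lt0n; apply/eqP.
  by rewrite -(cards1 y); apply: subset_leq_card; apply: subsetIl.
have := not_winnable t2L aff; rewrite /winning -ltnNge ltnNge => /negP[].
apply: leq_trans sy _; rewrite /sep.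
have -> : reach r (A t2 :\: ([set y] :&: A t2)) = reach r (A i :\: [set x; y]).
  rewrite setDIr setDv setU0 At2 Ai1 reach_reachD setDDl.
  by [].
by apply: subset_leq_card; apply: setSD; exact: (state_anti r f (leq0n i)).
Qed.

Lemma next_nonzero i : i < L -> exists t2, [/\ i < t2 <= L,
  forall j, i < j < t2 -> f j = 0 & f t2 <> 0 \/ t2 = L].
Proof.
move=> iL; have ex : exists t2, (i < t2) && ((f t2 != 0) || (t2 == L)).
  by exists L; rewrite iL eqxx orbT.
case: (ex_minnP ex) => t2 /andP[it h] mn; exists t2; split.
- by rewrite it mn // iL eqxx orbT.
- move=> j /andP[ij jt]; apply/eqP; apply: contraTT jt => fj.
  by rewrite -leqNgt mn // ij fj.
- by case/orP: h => /eqP; [left | right].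
Qed.

(* If two or more firefighters were available, each component that they touch
   could have been enclosed by two of them, hence is lighter than [s]; for a
   single firefighter the bound comes from the maximality of the score. *)
Lemma influence i S : i < L -> plan r (A i) i f S -> #|X i| = f i ->
  exists t2 (K : {set G}), [/\ i < t2 <= L, forall j, i < j < t2 -> f j = 0,
    [/\ K \subset A i, [disjoint B i & K], S i \subset K &
     forall u v, u \in A i -> v \in K -> edge u v -> (u \in B i) || (u \in K)] &
    #|K :\: ball r (A i :\: S i) t2| <= 10 * s * #|A i :\: A i.+1|].
Proof.
move=> iL pS Xf.
have rA : r \in A i by apply: root_state.
have cA : conn (A i) by rewrite /A -reach_state; apply: reach_conn.
have [cS SA dS] := pS i (leqnn i).
rewrite placed0 setD0 -/(B i) in dS.
have SAB : S i \subset A i :\: B i by rewrite subsetD SA.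
pose K := \bigcup_(x in S i) comp (A i :\: B i) x.
have KAB : K \subset A i :\: B i.
  by apply/bigcupsP => x xS; apply: comp_sub; apply: subsetP xS.
have SK : S i \subset K.
  by apply/subsetP => x xS; apply/bigcupP; exists x => //; apply: comp_root.
have Kok : [/\ K \subset A i, [disjoint B i & K], S i \subset K &
     forall u v, u \in A i -> v \in K -> edge u v -> (u \in B i) || (u \in K)].
  split=> //; first exact: subset_trans KAB (subsetDl _ _).
    by rewrite disjoint_sym; move: KAB; rewrite subsetD => /andP[].
  move=> u v uA /bigcupP[x xS vx] uv.
  have := comp_unburnt_sep (subsetP SAB _ xS) uA vx uv => /orP[->//|ux].
  by apply/orP; right; apply/bigcupP; exists x.
have [f1|f1] := eqVneq (f i) 1; last first.
  exists i.+1, K; split=> //; [by rewrite ltnSn | by move=> j; nlia |].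
  apply: (@leq_trans #|K|); first by apply: subset_leq_card; apply: subsetDl.
  apply: (@leq_trans (#|S i| * s)).
    rewrite /K -sum_nat_const.
    apply: (@leq_trans (\sum_(x in S i) #|comp (A i :\: B i) x|)).
      elim/big_ind2: _ => [|p P q Q pP qQ|//]; first by rewrite cards0.
      exact: leq_trans (leq_card_setU _ _) (leq_add pP qQ).
    apply: leq_sum => x xS; apply: ltnW; apply: (comp_unburnt_lt cG rA cA (subsetP SAB _ xS)).
    move=> p q pD qD; apply: not_winnable_sep => //; apply/andP; split.
      by apply/subsetP => z /set2P[]->.
    rewrite cards2; have : 0 < #|S i| by apply/card_gt0P; exists x.
    by case: (p != q) => /=; nlia.
  have := card_move_le i; rewrite Xf => h.
  rewrite mulnC -mulnA mulnCA leq_mul2l; apply/orP; right; nlia.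
have [t2 [it2 f0 ft2]] := next_nonzero iL.
exists t2, K; split=> //.
have /cards1P[x Xx] : #|X i| == 1 by rewrite Xf f1.
have dlt := delay_lt it2 f0 ft2 Xx.
have -> : A i :\: A i.+1 = sep r (A i) [set x] by rewrite -Xx.
have [S0|[x' x'S]] := set_0Vmem (S i).
  by rewrite /K S0 big_set0 set0D cards0.
have Sx' : S i = [set x'].
  by apply/eqP; rewrite eq_sym eqEcard sub1set x'S cards1 -f1.
have KE : K = comp (A i :\: B i) x' by rewrite /K Sx' big_set1.
have xAB : x \in A i :\: B i by apply: (subsetP (move_sub i)); rewrite Xx set11.
have iG : i <= #|G|.
  rewrite leqNgt; apply/negP => Gi; move: xAB.
  by rewrite /B (ball_full _ _ (ltnW Gi)) reach_state setDv inE.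
rewrite KE Sx'; apply: (delayed_le cG rA cA (subsetP SAB _ x'S)) dlt => //.
- by rewrite /L /horizon; nlia.
- move=> v vD; apply: not_winnable_sep => //; rewrite /affordable sub1set vD.
  by rewrite cards1 f1.
move=> v vD; case/andP: (moveP r (A i) i (f i)) => _.
rewrite (negbTE (not_winning iL)) => /and3P[_ _ /implyP bX].
have /forallP/(_ x) := bX (introT eqP f1).
by rewrite -/(X i) Xx set11 => /forallP/(_ v); rewrite vD.
Qed.

Lemma plan_le i S : i <= L -> plan r (A i) i f S ->
  #|sep r (A i) (placed_from S i)| <= 11 * s * #|A i :\: A L|.
Proof.
have [n] := ubnP (L - i); elim: n i S => // n IH i S ni iL pS.
have s0 := goal_gt0.
have sepB : sep r (A i) (placed_from S i) \subset A i :\: B i.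
  apply: setDS; rewrite /B.
  have dP : [disjoint placed_from S i & ball r (A i) i].
    by apply: placed_disjoint => j /pS[].
  by rewrite -(ball_setD dP); apply: ball_reach.
have [iL'|Li] := ltnP i L; last first.
  apply: leq_trans (subset_leq_card sepB) _.
  rewrite /B ball_full ?reach_state ?setDv ?cards0 //.
  by apply: leq_trans Li; rewrite /L /horizon leq_pmull.
have mv := moveP r (A i) i (f i); move: mv => /andP[_].
rewrite (negbTE (not_winning iL')) => /and3P[_ /eqP cX _].
have [le|lt] := leqP #|A i :\: B i| (f i).
  rewrite (minn_idPr le) in cX; apply: leq_trans (subset_leq_card sepB) _.
  rewrite -cX; apply: leq_trans (card_move_le i) _.
  rewrite (@card_gain i i.+1 L) ?leqnSn //; nia.
rewrite (minn_idPl (ltnW lt)) in cX.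
have [t2 [K [/andP[it2 t2L] f0 [KA dK SK sepK] cK]]] := influence iL' pS cX.
have rA : r \in A i by apply: root_state.
have [S' pS' le'] := plan_switch (X i) rA pS KA dK sepK SK it2 f0 cK.
have At2 : A t2 = A i.+1 by apply: idle_state => // k ik; apply: f0; nlia.
rewrite (_ : reach r (A i :\: X i) = A t2) in pS' le'; last by rewrite At2.
have := IH t2 S' _ t2L pS'; move=> /(_ ltac:(nlia)) le2.
apply: leq_trans le' _; rewrite (@card_gain i t2 L) ?(ltnW it2) // At2 in le2 *.
nia.
Qed.

End Competitive.

Section Saved.

Variables (G : sgraph) (r : G) (S : nat -> {set G}).
Hypothesis dS : forall j, [disjoint S j & burning r S j].

Lemma protectedP i v : reflect (exists2 l, l < i & v \in S l) (v \in protected S i).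
Proof.
apply: (iffP bigcupP) => [[l _ vl]|[l li vl]]; first by exists l.
by exists (Ordinal li).
Qed.

Lemma saved_reach : saved r S = ~: reach r (~: placed_from S 0).
Proof.
have bE i : burning r S i = ball r (~: placed_from S 0) i.
  rewrite burning_ball // -(@ball_setD _ _ _ (placed_from S i)).
    congr ball; apply/setP => v; rewrite in_setD !in_setC -negb_or; congr (~~ _).
    apply/orP/placed_fromP => [[/placed_fromP[l _ vl]|/protectedP[l _ vl]]|[l _ vl]].
    - by exists l.
    - by exists l.
    have [il|li] := leqP i l; last by right; apply/protectedP; exists l.
    by left; apply/placed_fromP; exists l.
  apply: placed_disjoint => j ij.
  have -> : ~: protected S i :\: placed S i j = ~: protected S j; last by rewrite -burning_ball.
  apply/setP => v; rewrite in_setD !in_setC -negb_or; congr (~~ _).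
  apply/orP/protectedP => [[/placedP[l /andP[_ lj] vl]|/protectedP[l li vl]]|[l lj vl]].
  - by exists l.
  - by exists l => //; apply: leq_trans ij.
  have [il|li] := leqP i l; last by right; apply/protectedP; exists l.
  by left; apply/placedP; exists l; rewrite ?il.
apply/setP => v; rewrite in_setC [LHS]inE; apply/asboolP/idP => [h|vr i].
  by apply/reachP => -[i]; rewrite -bE; apply/negP.
by apply: contra vr; rewrite bE => vi; apply/reachP; exists i.
Qed.

End Saved.

Section Upper.

Variables (G : sgraph) (r : G) (f : nat -> nat).
Let A0 := reach r [set: G].

Lemma legal_plan S : legal r f S -> let S' j := S j :&: A0 in
  plan r A0 0 f S' /\ saved r S = ~: A0 :|: sep r A0 (placed_from S' 0).
Proof.
move=> lS S'; have dS j : [disjoint S j & burning r S j].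
  by have [_] := lS j; apply: disjointWr; apply: subsetUl.
split.
  move=> j _; have [cS _] := lS j; split.
  - exact: leq_trans (subset_leq_card (subsetIl _ _)) cS.
  - exact: subsetIr.
  have -> : A0 :\: placed S' 0 j = A0 :\: protected S j.
    apply/setP => v; rewrite !in_setD; case vA: (v \in A0); rewrite ?andbF // !andbT.
    congr (~~ _); apply/placedP/protectedP => [[l lj]|[l lj vl]].
      by rewrite inE => /andP[vl _]; exists l.
    by exists l; rewrite // inE vl vA.
  rewrite ball_reachD setTD -burning_ball //.
  by apply: disjointWl (dS j); apply: subsetIl.
rewrite saved_reach // /sep.
have -> : A0 :\: placed_from S' 0 = A0 :\: placed_from S 0.
  apply/setP => v; rewrite !in_setD; case vA: (v \in A0); rewrite ?andbF // !andbT.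
  congr (~~ _); apply/placed_fromP/placed_fromP => [[l _]|[l _ vl]].
    by rewrite inE => /andP[vl _]; exists l.
  by exists l; rewrite // inE vl vA.
rewrite reach_reachD setTD; apply/setP => v; rewrite in_setU in_setD !in_setC.
case: (boolP (v \in A0)) => vA; rewrite ?orbT ?andbT //= .
by apply: contra vA; apply/subsetP/reach_mono/subsetT.
Qed.

Definition cactus_algorithm : online_algorithm :=
  @OnlineAlgorithm (@next_move) (@next_move_legal).

Lemma cactus_algorithm_ratio : cactus G ->
  goal G <= ALG cactus_algorithm r f \/
  OPT r f <= 11 * goal G * ALG cactus_algorithm r f.
Proof.
move=> cG; pose L := horizon G.
have algL : #|~: state r f L| <= ALG cactus_algorithm r f by apply: saved_ge.
have [won|lost] := leqP (goal G) #|A0 :\: state r f L|; [left|right].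
  apply: leq_trans won (leq_trans _ algL); apply: subset_leq_card.
  by apply/subsetP => v; rewrite !inE => /andP[].
apply/bigmax_leqP => -[k _] /= /asboolP[S [lS <-]].
have [pS ->] := legal_plan lS.
have s0 := goal_gt0 r.
have := plan_le cG lost (leq0n _) pS.
have h : #|~: state r f L| = #|~: A0| + #|A0 :\: state r f L|.
  rewrite -cardsUI [X in _ + #|pred_of_set X|](_ : _ = set0) ?cards0 ?addn0; last first.
    by apply/setP => v; rewrite !inE; case: asboolP; rewrite ?andbF.
  congr #|pred_of_set _|; apply/setP => v; rewrite !in_setU !in_setD !in_setC.
  case: (boolP (v \in A0)) => vA; rewrite ?andbT //= ?orbF.
  by apply: contra vA; apply/subsetP; apply: (state_anti r f (leq0n L)).
move=> le; apply: leq_trans (leq_card_setU _ _) _.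
apply: leq_trans (leq_mul (leqnn _) algL); rewrite h mulnDr.
apply: leq_add; last exact: le.
by rewrite leq_pmull // muln_gt0.
Qed.

End Upper.

Lemma cactus_algorithm_competitive (R : realType) :
  competitive cactus (fun n : nat => 15%:R * Num.sqrt n%:R + 1 : R)%R cactus_algorithm.
Proof.
move=> G r f cG; set a := ALG _ _ _.
have /andP[sn ns] := sqrt_bounds #|G|.
have s0 := goal_gt0 r.
set n := #|G| in sn ns *; set s := Nat.sqrt n in sn ns.
have {}s0 : 0 < s := s0.
have a0 : (0 <= a%:R :> R)%R by [].
pose q : R := Num.sqrt n%:R.
have sq : (s%:R <= q :> R)%R.
  by rewrite -(@ler_pXn2r _ 2) ?nnegrE ?sqrtr_ge0 // sqr_sqrtr // -natrX ler_nat -mulnn.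
have q0 : (0 <= q)%R := sqrtr_ge0 _.
have qs : (q <= 2 * s%:R :> R)%R.
  rewrite -(@ler_pXn2r _ 2) ?nnegrE ?mulr_ge0 // sqr_sqrtr // -natrM -natrX ler_nat.
  by nia.
have nq : (n%:R = q * q :> R)%R by rewrite -expr2 sqr_sqrtr.
have optn : OPT r f <= n.
  by apply/bigmax_leqP => -[k kn] _.
suff h : ((OPT r f)%:R <= 15 * q * a%:R :> R)%R.
  by apply: le_trans h _; rewrite [leRHS]mulrDl mul1r lerDl.
have [won|le] := cactus_algorithm_ratio r f cG.
  have : (s%:R <= a%:R :> R)%R by rewrite ler_nat.
  have : ((OPT r f)%:R <= n%:R :> R)%R by rewrite ler_nat.
  rewrite nq; nra.
have : ((OPT r f)%:R <= (11 * s * a)%:R :> R)%R by rewrite ler_nat.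
rewrite !natrM; nra.
Qed.

(** * The lower bound *)

Section RingStar.

Variable m : nat.
Notation n := (m * m).+2.
Definition ring_star_vertex := ('I_n + option 'I_m)%type.

Definition ring_star_edge (u v : ring_star_vertex) : bool :=
  match u, v with
  | inl i, inl j => (j == ordS i) || (i == ordS j)
  | inl i, inr None | inr None, inl i => i == ord0
  | inr None, inr (Some _) | inr (Some _), inr None => true
  | _, _ => false
  end.

Lemma ring_star_sym : symmetric ring_star_edge.
Proof. by move=> [i|[a|]] [j|[b|]] //=; rewrite orbC. Qed.

Lemma ring_star_irrefl : irreflexive ring_star_edge.
Proof.
move=> [i|[a|]] //=; rewrite orbb; apply/eqP => /(congr1 val) /=.
have := ltn_ord i; rewrite leq_eqVlt => /orP[/eqP e|lt].
  by rewrite e modnn => i0; move: e; rewrite i0.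
by rewrite modn_small //; lia.
Qed.

Definition ring_star : sgraph := SGraph ring_star_sym ring_star_irrefl.

Lemma ring_star_card : #|ring_star| = m * m + m + 3.
Proof. by rewrite /= card_sum card_option !card_ord; lia. Qed.

Lemma next_neq_prev (G : sgraph) (p : seq G) x :
  uniq p -> 2 < size p -> x \in p -> next p x != prev p x.
Proof.
move=> up sp xp; apply/eqP => e; have := next_prev up x; rewrite -e.
have [i q rq] := rot_to xp; rewrite -!(next_rot i up) rq.
move: up sp; rewrite -(rot_uniq i) -(size_rot i) rq next_cons.
case: q {rq} => [//|y [//|z q]] u _.
have e2 : next [:: x, y, z & q] y = z := @next_split _ y [:: x] (z :: q) u.
by rewrite [head _ _]/= e2 => zx; move: u; rewrite zx /= !inE eqxx orbT.
Qed.

Lemma iter_ordS (k : nat) (i : 'I_n) : iter k (@ordS _) i = (i + k) %% n :> nat.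
Proof.
elim: k => [|k IH]; first by rewrite addn0 modn_small.
by rewrite iterS /= IH -addn1 modnDml addn1 addnS.
Qed.

Lemma ring_star_cycle (p : seq ring_star) : simple_cycle p ->
  cycle_edges p = [set [set (inl i : ring_star); inl (ordS i)] | i : 'I_n].
Proof.
move=> [/andP[cp up] sp].
have nx x : x \in p -> next p x \in p by rewrite mem_next.
have px x : x \in p -> prev p x \in p by rewrite mem_prev.
have ne x (xp : x \in p) := next_neq_prev up sp xp.
have en x (xp : x \in p) : ring_star_edge x (next p x) := next_cycle cp xp.
have ep x (xp : x \in p) : ring_star_edge (prev p x) x := prev_cycle cp xp.
have noleaf a : inr (Some a) \notin p.
  apply/negP => ap; move: (ne _ ap) (en _ ap) (ep _ ap).
  by case: (next p _) => [//|[//|]]; case: (prev p _) => [//|[//|]].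
have nocenter : inr None \notin p.
  apply/negP => ap; move: (ne _ ap) (en _ ap) (ep _ ap) (nx _ ap) (px _ ap).
  case: (next p _) => [i|[a|//]]; last by rewrite (negbTE (noleaf a)).
  case: (prev p _) => [j|[a|//]]; last by rewrite (negbTE (noleaf a)).
  by move=> ij /= /eqP ei /eqP ej; rewrite ei ej eqxx in ij.
have nring i : inl i \in p -> exists2 j, next p (inl i) = inl j & (j == ordS i) || (i == ordS j).
  move=> ip; move: (en _ ip) (nx _ ip); case: (next p _) => [j e _|[a|]].
  - by exists j.
  - by rewrite (negbTE (noleaf a)).
  - by rewrite (negbTE nocenter).
have pring i : inl i \in p -> exists2 j, prev p (inl i) = inl j & (i == ordS j) || (j == ordS i).
  move=> ip; move: (ep _ ip) (px _ ip); case: (prev p _) => [j e _|[a|]].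
  - by exists j.
  - by rewrite (negbTE (noleaf a)).
  - by rewrite (negbTE nocenter).
have inj : injective (@ordS n) := can_inj (@ordSK _).
have succ i : inl i \in p ->
    inl (ordS i) \in p /\ [set (inl i : ring_star); inl (ordS i)] \in cycle_edges p.
  move=> ip; have [j nj /orP[/eqP ej|/eqP ej]] := nring i ip.
    rewrite -ej -nj; split; first exact: nx.
    by apply/imsetP; exists (inl i).
  have [k pk /orP[/eqP ek|/eqP ek]] := pring i ip.
    have := ne _ ip; rewrite nj pk; case/eqP; congr inl; apply: inj.
    by rewrite -ej -ek.
  rewrite -ek -pk; split; first exact: px.
  by apply/imsetP; exists (prev p (inl i)); rewrite ?px // next_prev // setUC.
have [i0 i0p] : exists i, inl i \in p.
  case: p sp {cp up nx px ne en ep nring pring succ} noleaf nocenter => [//|x p] _ h1 h2.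
  case: x h1 h2 => [i _ _|[a h1 _|_ h2]]; first by exists i; rewrite mem_head.
    by have := h1 a; rewrite mem_head.
  by rewrite mem_head in h2.
have all_in i : inl i \in p.
  have it k : inl (iter k (@ordS _) i0) \in p.
    by elim: k => [//|k /succ[]].
  have -> : i = iter (i + n - i0) (@ordS _) i0; last exact: it.
  apply: val_inj; rewrite /= iter_ordS.
  have lt := ltn_ord i0; rewrite subnKC; last by lia.
  by rewrite modnDr modn_small.
apply/setP => E; apply/imsetP/imsetP => [[x xp ->]|[i _ ->]].
  case: x xp => [i ip|[a|]]; last 2 first.
  - by rewrite (negbTE (noleaf a)).
  - by rewrite (negbTE nocenter).
  have [j -> /orP[/eqP->|/eqP->]] := nring i ip; first by exists i.
  by exists j => //; rewrite setUC.
by have [_ /imsetP] := succ i (all_in i).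
Qed.

Lemma ring_star_cactus : cactus ring_star.
Proof. by move=> u v _ p q cp cq _ _; rewrite !ring_star_cycle. Qed.

Let r : ring_star := inl ord0.
Let center : ring_star := inr None.
Let outer : {set ring_star} := [set inr x | x : option 'I_m].

Lemma card_outer : #|outer| = m.+1.
Proof. by rewrite card_imset ?card_option ?card_ord // => x y []. Qed.

Lemma ring_reach (P : {set ring_star}) k : (forall i, inl i \in P -> i = k) ->
  forall i, inl i \notin P -> inl i \in reach r (~: P).
Proof.
move=> Pk i iP; have [ik|ki] := leqP i k.
  suff h l (ln : l < n) : l <= i -> inl (Ordinal ln) \in reach r (~: P).
    by rewrite (_ : i = Ordinal (ltn_ord i)); [apply: h | apply: val_inj].
  elim: l ln => [|l IH] ln li.
    by rewrite (_ : Ordinal ln = ord0); [apply: reach_root | apply: val_inj].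
  have ln' : l < n by lia.
  apply: (reach_step (IH ln' (ltnW li))).
    rewrite inE; have [e|ne] := eqVneq (Ordinal ln) i; first by rewrite e.
    apply/negP => /Pk e; move/eqP: ne; apply; apply: val_inj => /=.
    by have := congr1 val e => /=; lia.
  by apply/orP; left; apply/eqP/val_inj; rewrite /= modn_small.
suff h d (ln : n.-1 - d < n) : i <= n.-1 - d -> inl (Ordinal ln) \in reach r (~: P).
  have e : n.-1 - (n.-1 - i) = i by have := ltn_ord i; lia.
  have ln : n.-1 - (n.-1 - i) < n by rewrite e.
  have -> : i = Ordinal ln by apply: val_inj; rewrite /= e.
  by apply: h; rewrite e.
have notP l (lt : l < n) : i <= l -> inl (Ordinal lt) \in ~: P.
  move=> il; rewrite inE; apply/negP => /Pk e; have := congr1 val e => /=; lia.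
elim: d ln => [|d IH] ln li.
  apply: (reach_step (reach_root _ _)); first exact: notP.
  by apply/orP; right; apply/eqP/val_inj; rewrite /= subn0 modnn.
have ln' : n.-1 - d < n by lia.
have le : n.-1 - d.+1 < n.-1 - d by have := ltn_ord i; lia.
apply: (reach_step (IH ln' (leq_trans li (ltnW le)))); first exact: notP.
apply/orP; right; apply/eqP/val_inj => /=.
by rewrite modn_small; lia.
Qed.

Lemma sparse_ring (P : {set ring_star}) : #|P :&: ~: outer| <= 1 ->
  exists k, forall i, inl i \in P -> i = k.
Proof.
move=> P1; have inlP i : inl i \in P -> inl i \in P :&: ~: outer.
  by move=> iP; rewrite !inE iP /=; apply/imsetP => -[].
have [e|[x]] := set_0Vmem (P :&: ~: outer).
  by exists ord0 => i /inlP; rewrite e inE.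
rewrite !inE => /andP[xP]; case: x xP => [k kP _|y _ /imsetP[]]; last by exists y.
exists k => i iP; have /card_le1P := P1; move=> /(_ (inl k) (inlP _ kP)) h.
by have := h (inl i); rewrite (inlP _ iP) inE => /esym/eqP[].
Qed.

End RingStar.

Section LowerGame.

Variable m : nat.
Hypothesis m2 : 1 < m.
Notation n := (m * m).+2.
Let G : sgraph := ring_star m.
Let r : G := inl ord0.
Let center : G := inr None.
Let outer : {set G} := [set inr x | x : option 'I_m].

Lemma saved_le_opt f S k : legal r f S -> k <= #|saved r S| -> k <= OPT r f.
Proof.
move=> lS kS; apply: leq_trans kS _.
have lt : #|saved r S| < #|G|.+1 by rewrite ltnS max_card.
apply: (@leq_bigmax_cond _ _ _ (Ordinal lt)).
by apply/asboolP; exists S.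
Qed.

Lemma legal_saved f S : legal r f S -> saved r S = ~: reach r (~: placed_from S 0).
Proof.
move=> lS; apply: saved_reach => j; have [_] := lS j.
by apply: disjointWr; apply: subsetUl.
Qed.

Lemma legal_idle f S j : legal r f S -> f j = 0 -> S j = set0.
Proof. by move=> lS f0; apply/eqP; rewrite -cards_eq0 -leqn0 -f0; case: (lS j). Qed.

Lemma opt_one : m < OPT r (fun j => j == 0).
Proof.
pose S j : {set G} := if j == 0 then [set center] else set0.
have lS : legal r (fun j => j == 0) S.
  move=> [|j]; rewrite /S /= ?cards1 ?cards0; last by rewrite -setI_eq0 set0I.
  by rewrite disjoints1 !inE /protected big_ord0 inE.
apply: (saved_le_opt lS); rewrite (legal_saved lS) -(card_outer m).
apply: subset_leq_card; apply/subsetP => x /imsetP[y _ ->] {x}.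
rewrite in_setC; apply/reachP => -[k]; elim: k y => [|k IH] y.
  by rewrite inE.
case/ballSP => [/IH //|[yP [u uk e]]].
case: u uk e => [i _|z /IH //]; case: y yP => [//|+ _].
rewrite in_setC => /negP[]; apply/placed_fromP; exists 0 => //.
by rewrite /S /= set11.
Qed.

Lemma opt_two : m * m <= OPT r (fun j => j < 2).
Proof.
have n1 : 1 < n by lia.
have nn : m * m < n by lia.
have mm : 3 < m * m by nia.
pose a : 'I_n := Ordinal n1; pose b : 'I_n := Ordinal nn.
pose S j : {set G} := if j == 0 then [set inl a] else if j == 1 then [set inl b] else set0.
have lS : legal r (fun j => j < 2) S.
  move=> [|[|j]]; rewrite /S /= ?cards1 ?cards0; last by rewrite -setI_eq0 set0I.
    by rewrite disjoints1 !inE /protected big_ord0 inE.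
  rewrite disjoints1 in_setU negb_or /protected big_ord1 /= !inE; split=> //.
  apply/andP; split; last by apply/eqP => -[]; nlia.
  rewrite negb_or; apply/andP; split; first by apply/eqP => -[]; lia.
  rewrite negb_and; apply/orP; right; apply/existsPn => u; rewrite inE negb_and.
  have [->|//] := eqVneq u r; apply/orP; right.
  rewrite /= negb_or; apply/andP; split; apply/eqP => /(congr1 val) /=.
    by rewrite modn_small; lia.
  by rewrite modn_small; lia.
apply: (saved_le_opt lS); rewrite (legal_saved lS).
pose g (i : 'I_(m * m)) : G := inl (inord i.+1).
have gv (i : 'I_(m * m)) : (inord i.+1 : 'I_n) = i.+1 :> nat.
  by rewrite inordK // ltnS; apply: leqW; apply: ltn_ord.
have inj : injective g.
  move=> i j [] /(congr1 val) /=; rewrite !gv => -[]; exact: val_inj.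
rewrite -[m * m]card_ord -(card_imset _ inj); apply: subset_leq_card.
apply/subsetP => x /imsetP[i _ ->] {x}.
rewrite in_setC; apply/reachP => -[k].
have [j -> jb] : exists2 j : 'I_n, g i = inl j & 0 < j <= m * m.
  by exists (inord i.+1) => //; rewrite gv ltn_ord.
elim: k j jb => [|k IH] j jb.
  by rewrite inE => /eqP[e]; rewrite e in jb.
case/ballSP => [/(IH _ jb) //|[jP [u uk e]]].
have [ja jb'] : j <> a /\ j <> b.
  by split=> e'; move: jP; rewrite in_setC => /negP[]; apply/placed_fromP;
    [exists 0 | exists 1]; rewrite // /S /= e' set11.
have {}ja : j <> 1 :> nat by move=> e'; apply: ja; apply: val_inj.
have {}jb' : j <> m * m :> nat by move=> e'; apply: jb'; apply: val_inj.
case: u uk e => [l lk|[?|] _] //=; last by move/eqP => e; rewrite e in jb.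
have ln := ltn_ord l; have jn := ltn_ord j.
move=> e; apply: (IH l) => //; case/orP: e => /eqP/(congr1 val) /=.
  have [l1|l1] := ltnP l.+1 n; first by rewrite modn_small //; lia.
  by have -> : l.+1 = n by [lia]; rewrite modnn; lia.
by rewrite modn_small //; lia.
Qed.

Lemma saved_one_le S : legal r (fun j => j == 0) S -> S 0 <> [set center] ->
  #|saved r S| <= 1.
Proof.
move=> lS nc; have [S1 dS] := lS 0.
have PS : placed_from S 0 = S 0.
  apply/setP => v; apply/placed_fromP/idP => [[[|l] _ //]|vS]; last by exists 0.
  by rewrite (legal_idle lS) // inE.
have cS : center \notin S 0.
  by apply/negP => cS; apply: nc; apply/esym/eqP; rewrite eqEcard sub1set cS cards1.
have [k Pk] : exists k, forall i, inl i \in S 0 -> i = k.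
  by apply: sparse_ring; apply: leq_trans S1; apply: subset_leq_card; apply: subsetIl.
apply: leq_trans S1; rewrite (legal_saved lS) PS; apply: subset_leq_card.
apply/subsetP => v; rewrite in_setC; apply: contraR => vS.
have cR : center \in reach r (~: S 0).
  by apply: (reach_step (reach_root _ _)); rewrite ?inE.
case: v vS => [i|[a|//]] vS; first exact: ring_reach Pk _ vS.
by apply: (reach_step cR); rewrite ?inE.
Qed.

Lemma saved_two_le S : legal r (fun j => j < 2) S -> S 0 = [set center] ->
  #|saved r S| <= m.+2.
Proof.
move=> lS S0; have [S1 _] := lS 1.
have PS v : v \in placed_from S 0 -> v = center \/ v \in S 1.
  case/placed_fromP => [[|[|l]]] _; [by rewrite S0 => /set1P; left | by right |].
  by rewrite (legal_idle lS) // inE.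
have [k Pk] : exists k, forall i, inl i \in S 1 -> i = k.
  by apply: sparse_ring; apply: leq_trans S1; apply: subset_leq_card; apply: subsetIl.
have Pk' i : inl i \in placed_from S 0 -> i = k by case/PS => [//|/Pk].
apply: (@leq_trans #|outer :|: S 1|); last first.
  by apply: leq_trans (leq_card_setU _ _) _; rewrite card_outer; lia.
rewrite (legal_saved lS); apply: subset_leq_card; apply/subsetP => v.
rewrite in_setC; apply: contraR; rewrite in_setU negb_or => /andP[vo vS].
case: v vo vS => [i _ vS|x /imsetP[]]; last by exists x.
by apply: (ring_reach Pk'); apply: contra vS => /PS[].
Qed.

(* After one firefighter was announced, the adversary goes on with a second
   one precisely if the first one was put on the centre of the star. *)
Lemma adversary (A : online_algorithm) : exists f,
  (m < OPT r f /\ ALG A r f <= 1) \/ (m * m <= OPT r f /\ ALG A r f <= m.+2).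
Proof.
have [c|nc] := pselect (decide A r [:: 1] = [set center]).
  exists (fun j => j < 2); right; split; first exact: opt_two.
  exact: saved_two_le (decide_legal A r _) c.
exists (fun j => j == 0); left; split; first exact: opt_one.
exact: saved_one_le (decide_legal A r _) nc.
Qed.

End LowerGame.

Local Open Scope classical_set_scope.
Local Open Scope ring_scope.

Lemma not_competitive (R : realType) (A : online_algorithm) (c : nat -> R) :
  c =o_\oo (fun n : nat => Num.sqrt n%:R : R) -> ~ competitive cactus c A.
Proof.
move=> /eqoP co comp.
have [N _ hN] := co 8%:R^-1 ltac:(by rewrite invr_gt0).
pose m := (N + 2)%N.
have m2 : (1 < m)%N by rewrite /m; lia.
have [f hf] := adversary m2 A.
have := comp (ring_star m) (inl ord0) f (@ring_star_cactus m); rewrite ring_star_card.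
set n := (m * m + m + 3)%N; set a := ALG _ _ _ in hf *; set o := OPT _ _ in hf *.
move=> le; have := hN n; rewrite /= => /(_ ltac:(rewrite /n /m; nia)).
have q0 : 0 <= Num.sqrt n%:R :> R := sqrtr_ge0 _.
rewrite (ger0_norm q0) => cn.
have qm : Num.sqrt n%:R <= 2 * m%:R :> R.
  rewrite -(@ler_pXn2r _ 2) ?nnegrE ?mulr_ge0 // sqr_sqrtr // -natrM -natrX ler_nat.
  by rewrite /n; nia.
have le2 : o%:R <= `|c n| * a%:R :> R.
  by apply: le_trans le _; rewrite ler_wpM2r // ler_norm.
have c0 := normr_ge0 (c n).
have m2' : 2 <= m%:R :> R by rewrite ler_nat.
have a0 : 0 <= a%:R :> R by [].
case: hf => -[ho ha].
  have ho' : m%:R <= o%:R :> R by rewrite ler_nat ltnW.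
  have ha' : a%:R <= 1 :> R by rewrite lern1.
  nra.
have ho' : m%:R * m%:R <= o%:R :> R by rewrite -natrM ler_nat.
have ha' : a%:R <= m%:R + 2 :> R by rewrite -natrD ler_nat addn2.
have : `|c n| * a%:R <= m%:R / 4 * (m%:R + 2) by apply: ler_pM => //; lra.
nra.
Qed.

Theorem theorem3 (R : realType) :
  (exists A : online_algorithm,
     competitive cactus (fun n : nat => 15%:R * Num.sqrt n%:R + 1 : R) A) /\
  (forall (A : online_algorithm) (c : nat -> R),
     c =o_\oo (fun n : nat => Num.sqrt n%:R : R) ->
     ~ competitive cactus c A).
Proof.
split; first by exists cactus_algorithm; apply: cactus_algorithm_competitive.
exact: not_competitive.
Qed.
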